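(* For every $\Theta>0$ there exist real numbers $\lambda_1,\lambda_2$ with $\lambda_1\lambda_2\geq 0$ and $\lambda_1+\lambda_2>0$, and functions $u,v\in H^1(\mathbb{R}^3\times\mathbb{T})$ with $u>0$ and $v>0$, such that \[ \begin{cases} -\Delta_{x,y}u+\lambda_1 u=|u|^2u+u|v|^2 & \text{in } \mathbb{R}^3\times\mathbb{T},\\ -\Delta_{x,y}v+\lambda_2 v=|v|^2v+v|u|^2 & \text{in } \mathbb{R}^3\times\mathbb{T},\\ \int_{\mathbb{R}^3\times\mathbb{T}}u^2\,dx\,dy=\int_{\mathbb{R}^3\times\mathbb{T}}v^2\,dx\,dy=\Theta^2 . \end{cases} \]
   Context: $\mathbb{T}=\mathbb{R}/2\pi\mathbb{Z}$ is the one-dimensional torus of length $2\pi$; points of $\mathbb{R}^3\times\mathbb{T}$ are written $(x,y)$ with $x\in\mathbb{R}^3$, $y\in\mathbb{T}$, and $\Delta_{x,y}$ is the Laplacian in all four variables. Functions are real-valued and the equations are understood in the weak sense. *)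

(* Defs.v *)
From HB Require Import structures.
From mathcomp Require Import all_boot all_order all_algebra.
From mathcomp Require Import all_classical all_reals all_analysis.
Set Implicit Arguments. Unset Strict Implicit. Unset Printing Implicit Defensive.
Import Order.TTheory GRing.Theory Num.Theory.
Import numFieldNormedType.Exports.
Local Open Scope classical_set_scope.
Local Open Scope ring_scope.

(* Points of R^3 x R are nested pairs ((x1, x2), x3), y).  Functions on
   R^3 x T are represented as functions on R^3 x R that are 2pi-periodic in y. *)
Definition pt (R : realType) := (R * R * R * R)%type.

Section defs.
Variable R : realType.
Implicit Types (p : pt R) (f : pt R -> R).

Definition coord (i : 'I_4) p : R :=
  match val i with
  | 0 => p.1.1.1 | 1 => p.1.1.2 | 2 => p.1.2 | _ => p.2 end.

Definition upd (i : 'I_4) p (t : R) : pt R :=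
  match val i with
  | 0 => (t, p.1.1.2, p.1.2, p.2)
  | 1 => (p.1.1.1, t, p.1.2, p.2)
  | 2 => (p.1.1.1, p.1.1.2, t, p.2)
  | _ => (p.1.1.1, p.1.1.2, p.1.2, t) end.

Definition partial (i : 'I_4) f : pt R -> R :=
  fun p => derive1 (fun t => f (upd i p t)) (coord i p).

Definition iter_partial (l : seq 'I_4) f : pt R -> R :=
  foldr partial f l.

Definition smooth f :=
  (forall l, continuous (iter_partial l f)) /\
  (forall l i p, derivable (fun t => iter_partial l f (upd i p t)) (coord i p) 1).

Definition periodic_y f := forall p, f (upd ord_max p (p.2 + 2 * pi)) = f p.

Definition test_fun f :=
  smooth f /\ periodic_y f /\
  exists M : R, forall p,
    M < `|p.1.1.1| \/ M < `|p.1.1.2| \/ M < `|p.1.2| -> f p = 0.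

Definition mu4 := (((@lebesgue_measure R) \x (@lebesgue_measure R))
                     \x (@lebesgue_measure R) \x (@lebesgue_measure R))%E.

(* fundamental domain of R^3 x T *)
Definition dom4 : set (pt R) := [set p | 0 <= p.2 < 2 * pi].

Definition integral4 f : R := Rintegral mu4 dom4 f.

Definition L2 f :=
  measurable_fun dom4 f /\ mu4.-integrable dom4 (fun p => (f p ^+ 2)%:E).

Definition weak_grad f (g : 'I_4 -> pt R -> R) :=
  forall phi, test_fun phi -> forall i,
    integral4 (fun p => f p * partial i phi p) =
    - integral4 (fun p => g i p * phi p).

Definition H1 f :=
  periodic_y f /\ L2 f /\
  exists g, (forall i, L2 (g i)) /\ weak_grad f g.

(* weak form of  -Delta u + lam u = u^3 + u w^2  with weak gradient g of u *)
Definition weak_eq (lam : R) u (g : 'I_4 -> pt R -> R) (w : pt R -> R) :=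
  forall phi, test_fun phi ->
    integral4 (fun p => \sum_(i < 4) g i p * partial i phi p + lam * u p * phi p) =
    integral4 (fun p => (`|u p| ^+ 2 * u p + u p * `|w p| ^+ 2) * phi p).

End defs.

(* Main.v *)
From HB Require Import structures.
From mathcomp Require Import all_boot all_order all_algebra.
From mathcomp Require Import all_classical all_reals all_analysis.
From mathcomp Require Import measurable_realfun ring lra.
Require Import Defs.
Set Implicit Arguments. Unset Strict Implicit. Unset Printing Implicit Defensive.
Import Order.TTheory GRing.Theory Num.Theory.
Import numFieldNormedType.Exports.
Local Open Scope classical_set_scope.
Local Open Scope ring_scope.

(* The solution has equal components, does not depend on y and is radial in x:
   u = v = w(|x|) with - w'' - 2 w' / r + lam w = 2 w^3.  The rescaling
   w |-> k w(k r) turns lam into k^2 lam and divides the mass by k, so it suffices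
   to find one positive decaying w for lam = 1, up to a factor in front of w^3.

   In terms of z = r w the equation reads z - z'' = c z^3 / r^2 on the half-line
   with z(0) = 0, i.e. z is proportional to T z = int G(r, s) z(s)^3 / s^2 ds with G
   the Green function of 1 - d^2/dr^2.  Such a z is the limit of the power
   iteration z |-> T z / |T z|, normalised in L^4(dr / r^2): since G is positive
   definite the energies increase, and the equality case of Young's inequality
   identifies the limit as a fixed point.  A convergent subsequence exists because
   for every iterate e^r z(r) is nondecreasing and z(r) / sinh r is nonincreasing,
   and the bound G(r, s)^2 <= min(r, 1) min(s, 1) dominates all the integrals.

   The weak formulation in R^3 x T follows from Fubini's theorem and integration by
   parts along almost every line parallel to an axis. *)

(** * Measurability and integrability on the line *)

Section basics.
Variable R : realType.
Local Notation mu := (@lebesgue_measure R).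

(** The cubic power is Sobolev-critical in dimension four, so a direct variational argument on R^3 x
    T would face a loss of compactness. Independence of [y] makes the problem three-dimensional,
    hence subcritical.

    For [z = r w] the measure [r^2 dr] of the L^4 norm becomes the weight [1 / r^2]. Its decay
    provides compactness at infinity; its singularity at 0 is the obstacle. The square root of the
    Green function gives, by Cauchy-Schwarz, [T z <= sqrt(energy) * sqrt(min(r, 1))], whose fourth
    power cancels the weight near 0. As energies only increase, the normalisation never degenerates
    and one constant bounds all iterates, so dominated convergence does the work of a compact
    embedding. Hölder's inequality enters as Young's inequality, and Cauchy-Schwarz as a completed
    square, so that only integrals of nonnegative functions need comparing.

    The second obstacle is the centre: the radial equation is known for [r > 0] only. Bounds on the
    profile and on its derivative divided by [r] replace smoothness there, and the lines that may
    meet the singular set are discarded as a null set. *)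

(** Inversion is continuous off 0 only; the point 0, where the inverse is 0 by convention, is split
    off. *)
Lemma measurable_inv : measurable_fun [set: R] (@GRing.inv R).
Proof.
have -> : @GRing.inv R = fun x => if (x == 0) then 0 else x^-1.
  by apply/funext => x; case: eqP => // ->; rewrite invr0.
apply: measurable_fun_if => //.
  by apply: measurable_fun_eqr.
rewrite setTI.
have -> : eq_op^~ (0:R) @^-1` [set false] = [set x | x != 0].
  by apply/seteqP; split => x /=; case: eqP.
apply: open_continuous_measurable_fun.
  exact: open_neq.
by move=> x /[!inE] x0; apply: inv_continuous.
Qed.

Lemma measurable_funV d (T : measurableType d) (f : T -> R) :
  measurable_fun [set: T] f -> measurable_fun [set: T] (fun x => (f x)^-1).
Proof. by move=> mf; apply: (measurableT_comp measurable_inv). Qed.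

Lemma measurable_funsqrt d (T : measurableType d) (f : T -> R) :
  measurable_fun [set: T] f -> measurable_fun [set: T] (fun x => Num.sqrt (f x)).
Proof.
by move=> mf; apply: measurableT_comp => //; apply: continuous_measurable_fun; exact: sqrt_continuous.
Qed.

Lemma integrable_dominated d (T : measurableType d) (m : {measure set T -> \bar R})
    (f g : T -> R) :
  measurable_fun setT f -> (forall x, `|f x| <= g x) ->
  m.-integrable setT (EFin \o g) -> m.-integrable setT (EFin \o f).
Proof.
move=> mf fg; apply: le_integrable => //; first exact/measurable_EFinP.
by move=> x _ /=; rewrite lee_fin (le_trans (fg x))// ler_norm.
Qed.

Lemma integrableZ d (T : measurableType d) (m : {measure set T -> \bar R})
    (f : T -> R) (c : R) :
  m.-integrable setT (EFin \o f) -> m.-integrable setT (EFin \o (fun x => c * f x)).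
Proof. by move=> fi; apply: (integrableZl measurableT c fi). Qed.

Lemma integral0y_oneDsqrV :
  (\int[mu]_(x in `[0%R, +oo[) ((oneDsqr x)^-1)%:E = (pi / 2)%:E)%E.
Proof.
rewrite (@ge0_continuous_FTC2y _ _ (@atan R) 0 (pi/2)).
- by rewrite atan0 sube0.
- by move=> x _; rewrite invr_ge0 (le_trans ler01).
- by apply: continuous_subspaceT; exact: continuous_oneDsqrV.
- exact: cvgy_atan.
- by move=> x _; exact: derivable_atan.
- by apply: cvg_at_right_filter; exact: continuous_atan.
- by move=> x _; rewrite derive1_atan.
Qed.

(** Source of the main majorants: it dominates [kap] on the line, and its product over three
    coordinates dominates squares of functions on R^3 decaying like the inverse cube of the
    radius. *)
Lemma integrable_oneDsqrV : mu.-integrable setT (fun x => ((oneDsqr x)^-1)%:E).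
Proof.
have c0 : continuous (fun x : R => (oneDsqr x)^-1) by exact: continuous_oneDsqrV.
apply/integrableP; split.
  by apply/measurable_EFinP; apply: continuous_measurable_fun.
under eq_integral do rewrite gee0_abs ?lee_fin ?invr_ge0 ?(le_trans ler01)//.
rewrite ge0_symfun_integralT//=.
- rewrite (_ : [set x | _] = `[0, +oo[%classic); last first.
    by apply/seteqP; split => x/=; rewrite in_itv/= andbT.
  by rewrite integral0y_oneDsqrV -EFinM ltry.
- by move=> x; rewrite /= /oneDsqr sqrrN.
Qed.

End basics.

Ltac meas1 := first
  [ assumption | exact: measurable_cst | exact: measurable_id
  | exact: measurable_fst | exact: measurable_snd
  | exact: measurable_expR
  | apply: measurable_funV | apply: measurable_funX | apply: measurable_funsqrt
  | apply: measurable_funD | apply: measurable_funB | apply: measurable_funM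
  | apply: measurable_funN
  | apply: measurable_maxr | apply: measurable_minr
  | apply: measurable_fun_ltr | apply: measurable_fun_ler | apply: measurable_and
  | (apply: measurable_fun_ifT)
  | (apply: (measurableT_comp (@measurable_expR _))) ].
Ltac meas := repeat meas1.

(** * Differentiation rules with explicit derivatives *)

Section der.
Variable R : realType.
Implicit Types (f g : R -> R) (x a b : R).
Lemma der_add f g x a b : is_derive x 1 f a -> is_derive x 1 g b ->
  is_derive x 1 (fun t => f t + g t) (a + b).
Proof. exact: is_deriveD. Qed.
Lemma der_sub f g x a b : is_derive x 1 f a -> is_derive x 1 g b ->
  is_derive x 1 (fun t => f t - g t) (a - b).
Proof. exact: is_deriveB. Qed.
Lemma der_mul f g x a b : is_derive x 1 f a -> is_derive x 1 g b ->
  is_derive x 1 (fun t => f t * g t) (a * g x + f x * b).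
Proof. by move=> ? ?; apply: is_derive_eq; rewrite /GRing.scale/=; ring. Qed.
Lemma der_cst x a : is_derive x 1 (fun=> a) 0.
Proof. exact: is_derive_cst. Qed.
Lemma der_id x : is_derive x 1 (fun t : R => t) 1.
Proof. exact: is_derive_id. Qed.
Lemma der_comp f g x a b : is_derive x 1 f a -> is_derive (f x) 1 g b ->
  is_derive x 1 (fun t => g (f t)) (a * b).
Proof. move=> fa gb. rewrite mulrC. exact: (is_derive1_comp gb fa). Qed.
Lemma der_exp f x a : is_derive x 1 f a ->
  is_derive x 1 (fun t => expR (f t)) (a * expR (f x)).
Proof. by move=> fa; apply: (der_comp fa); exact: is_derive_expR. Qed.
Lemma der_inv f x a : f x != 0 -> is_derive x 1 f a ->
  is_derive x 1 (fun t => (f t)^-1) (- a / f x ^+ 2).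
Proof. by move=> fx fa; apply: (is_derive_eq (is_deriveV fx fa)); rewrite /GRing.scale/=; ring. Qed.
Lemma der_opp f x a : is_derive x 1 f a -> is_derive x 1 (fun t => - f t) (- a).
Proof. exact: is_deriveN. Qed.
Lemma der_sqr f x a : is_derive x 1 f a -> is_derive x 1 (fun t => f t ^+ 2) (2 * f x * a).
Proof. by move=> fa; apply: (is_derive_eq (der_mul fa fa)); ring. Qed.
Lemma der_div f g x a b : g x != 0 -> is_derive x 1 f a -> is_derive x 1 g b ->
  is_derive x 1 (fun t => f t / g t) ((a * g x - f x * b) / g x ^+ 2).
Proof.
by move=> gx fa gb; apply: (is_derive_eq (der_mul fa (der_inv gx gb))); field.
Qed.
Lemma der_continuous f x a : is_derive x 1 f a -> {for x, continuous f}.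
Proof. by move=> fa; apply: differentiable_continuous; apply/derivable1_diffP; exact: ex_derive. Qed.
Lemma der_derivable f x a : is_derive x 1 f a -> derivable f x 1.
Proof. by move=> fa; exact: ex_derive. Qed.
Lemma der_derive1 f x a : is_derive x 1 f a -> (f^`()%classic) x = a.
Proof. by move=> fa; rewrite derive1E; exact: derive_val. Qed.
End der.

(** * The Green function on the half-line *)

Section kernel.
Variable R : realType.
Local Notation mu := (@lebesgue_measure R).
Implicit Types r s t : R.

(* The Green function satisfies [green r s <= sg r * sg s], so multiples of [sg]
   dominate all the iterates; [kap] is the resulting integrable majorant. *)
Definition sg r := Num.sqrt (Num.min r 1).
Definition kap r := sg r ^+ 4 / r ^+ 2.
(* [green] is the Green function of [1 - d^2/dr^2] on the half-line with Dirichlet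
   condition at 0, and [ak] its square root: [green r s = int ak t r * ak t s dt]. *)
Definition ak t s := if (0 < t) && (t < s) then expR (t - s) else 0.
Definition green r s := if (0 < r) && (0 < s) then
   expR (- Num.max r s) * (expR (Num.min r s) - expR (- Num.min r s)) / 2 else 0.

Lemma sg_ge0 r : 0 <= sg r. Proof. exact: sqrtr_ge0. Qed.

Lemma sg_le0 r : r <= 0 -> sg r = 0.
Proof. by move=> r0; rewrite /sg ler0_sqrtr// ge_min r0. Qed.

Lemma sg_sqr r : 0 <= r -> sg r ^+ 2 = Num.min r 1.
Proof. by move=> r0; rewrite sqr_sqrtr// le_min r0 ler01. Qed.

Lemma sg_gt0 r : 0 < r -> 0 < sg r.
Proof. by move=> r0; rewrite sqrtr_gt0 lt_min r0 ltr01. Qed.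

Lemma sg_le1 r : sg r <= 1.
Proof. by rewrite -[leRHS]sqrtr1 ler_wsqrtr// ge_min lexx orbT. Qed.

Lemma kap_ge0 r : 0 <= kap r.
Proof. by rewrite divr_ge0// ?sqr_ge0// exprn_ge0// sg_ge0. Qed.

Lemma measurable_sg : measurable_fun setT sg.
Proof. by rewrite /sg; meas. Qed.

Lemma measurable_kap : measurable_fun setT kap.
Proof. by rewrite /kap; meas; exact: measurable_sg. Qed.

(** [kap] is 1 on []0, 1]], the inverse square beyond, and 0 for [r <= 0]. *)
Lemma kap_le r : kap r <= 2 * (oneDsqr r)^-1.
Proof.
have h : 0 < oneDsqr r by rewrite (lt_le_trans ltr01).
rewrite /kap; have [r0|r0] := leP r 0.
  by rewrite sg_le0// expr0n mul0r mulr_ge0// invr_ge0 (ltW h).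
rewrite ler_pdivlMr// mulrAC ler_pdivrMr ?exprn_gt0//.
rewrite (_ : 4 = 2 * 2)%N// exprM (sg_sqr (ltW r0)) /oneDsqr.
have [r1|r1] := leP r 1; last by nra.
have : r ^+2 <= 1 by nra.
have : 0 <= r ^+ 2 by nra.
by nra.
Qed.

Lemma integrable_kap : mu.-integrable setT (EFin \o kap).
Proof.
apply: (@integrable_dominated _ _ _ mu _ (fun x => 2 * (oneDsqr x)^-1)).
- exact: measurable_kap.
- by move=> x; rewrite ger0_norm ?kap_ge0// kap_le.
- by apply: integrableZ; exact: integrable_oneDsqrV.
Qed.

Lemma ak_ge0 t s : 0 <= ak t s.
Proof. by rewrite /ak; case: ifP => // _; exact: expR_ge0. Qed.

Lemma measurable_ak : measurable_fun setT (fun x : R * R => ak x.1 x.2).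
Proof. by rewrite /ak; meas. Qed.

Lemma measurable_green : measurable_fun setT (fun x : R * R => green x.1 x.2).
Proof. by rewrite /green; meas. Qed.

Lemma greenC r s : green r s = green s r.
Proof. by rewrite /green andbC maxC minC. Qed.

Lemma green_le0 r s : r <= 0 -> green r s = 0.
Proof. by move=> r0; rewrite /green ltNge r0. Qed.

Lemma greenE r s : 0 < r -> r <= s ->
  green r s = expR (- s) * (expR r - expR (- r)) / 2.
Proof.
move=> r0 rs; rewrite /green r0 (lt_le_trans r0 rs)/=.
by rewrite max_r// min_l.
Qed.

Lemma green_gt0 r s : 0 < r -> 0 < s -> 0 < green r s.
Proof.
have H (x y : R) : 0 < x -> x <= y -> 0 < green x y.
  move=> x0 xy; rewrite greenE// divr_gt0// mulr_gt0 ?expR_gt0//.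
  by rewrite subr_gt0 ltr_expR; lra.
move=> r0 s0; have [rs|rs] := leP r s; first exact: H.
by rewrite greenC; apply: H => //; exact: ltW.
Qed.

Lemma green_ge0 r s : 0 <= green r s.
Proof.
have [r0|r0] := leP r 0; first by rewrite green_le0.
have [s0|s0] := leP s 0; first by rewrite greenC green_le0.
exact/ltW/green_gt0.
Qed.

(** At the smaller argument [x] the kernel is at most its diagonal value [(1 - expR (- 2x)) / 2],
    hence at most [min x 1 = sg x ^+ 2]; monotonicity of [sg] then trades one factor [sg x] for
    [sg y]. *)
Lemma green_le r s : green r s <= sg r * sg s.
Proof.
have H (x y : R) : 0 < x -> x <= y -> green x y <= sg x * sg y.
  move=> x0 xy; have y0 := lt_le_trans x0 xy.
  have gm : green x y <= sg x ^+ 2.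
    rewrite greenE//.
    have e1 : expR (- y) * (expR x - expR (- x)) <= 1 - expR (- (2 * x)).
      rewrite mulrBr -!expRD (_ : - (2 * x) = - x - x); last by ring.
      have a1 : expR (-y + x) <= expR 0 by rewrite ler_expR; lra.
      apply: (@le_trans _ _ (expR (- y + x) * (1 - expR (- x - x)))).
        by rewrite mulrBr mulr1 -expRD lerB// ler_expR; lra.
      by rewrite expR0 in a1; rewrite ler_piMl// subr_ge0 -[leRHS]expR0 ler_expR; lra.
    rewrite (sg_sqr (ltW x0)) le_min.
    have := expR_ge1Dx (- (2 * x)); have := expR_gt0 (- (2 * x)).
    by move=> h1 h2; apply/andP; split; lra.
  apply: (le_trans gm); rewrite expr2 ler_wpM2l ?sg_ge0//.
  by rewrite ler_wsqrtr// le_min !ge_min xy lexx orbT.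
have [r0|r0] := leP r 0; first by rewrite green_le0// mulr_ge0 ?sg_ge0.
have [s0|s0] := leP s 0; first by rewrite greenC green_le0// mulr_ge0 ?sg_ge0.
have [rs|rs] := leP r s; first exact: H.
by rewrite greenC mulrC; apply: H => //; exact: ltW.
Qed.

Lemma green_diag r : green r r <= sg r ^+ 2.
Proof. by rewrite expr2 green_le. Qed.

(** The factor [expR r] makes the decaying branch [r >= s] constant and the branch [r <= s]
    increasing. *)
Lemma green_expR_nd r r' s : r <= r' -> expR r * green r s <= expR r' * green r' s.
Proof.
move=> rr'; have [r0|r0] := leP r 0.
  by rewrite green_le0// mulr0 mulr_ge0 ?expR_ge0 ?green_ge0.
have [s0|s0] := leP s 0; first by rewrite !(greenC _ s) !green_le0// !mulr0.
have L x : x <= s -> 0 < x -> expR x * green x s = expR (- s) * (expR (x + x) - 1) / 2.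
  by move=> xs x0; rewrite greenE// !mulrA -(mulrC (expR (- s))) -!mulrA; congr (_ * _);
    rewrite mulrA mulrBr -!expRD subrr expR0.
have U x : s <= x -> expR x * green x s = (expR s - expR (- s)) / 2.
  by move=> xs; rewrite greenC greenE// !mulrA -expRD subrr expR0 mul1r.
have [r's|r's] := leP r' s.
  rewrite !L// ?(le_trans rr')// ?(lt_le_trans r0)//.
  by rewrite ler_pM2r// ler_wpM2l ?expR_ge0// lerD2r ler_expR lerD.
have [rs|rs] := leP r s; last by rewrite !U// ltW.
rewrite L// (U r' (ltW r's)) ler_pM2r// mulrBr -expRD mulr1 lerD2r ler_expR; lra.
Qed.

(** Divided by the hyperbolic sine, the branch [r <= s] is constant, and beyond [s] the quotient is
    a multiple of [expR (- r) / sinh r], which decreases. The inequality is cross-multiplied to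
    avoid quotients. *)
Lemma green_sinh_ni r r' s : 0 < r -> r <= r' ->
  green r' s * (expR r - expR (- r)) <= green r s * (expR r' - expR (- r')).
Proof.
move=> r0 rr'; have r'0 := lt_le_trans r0 rr'.
have sh (x : R) : 0 < x -> 0 < expR x - expR (- x).
  by move=> x0; rewrite subr_gt0 ltr_expR; lra.
have [s0|s0] := leP s 0; first by rewrite !(greenC _ s) !green_le0// !mul0r.
have h (x : R) : x < r' -> expR (- r') * (expR x - expR (- x)) <=
    expR (- x) * (expR r' - expR (- r')).
  move=> xr'; rewrite !mulrBr -!expRD.
  have : expR (- r' + x) <= expR (- x + r') by rewrite ler_expR; lra.
  by rewrite (addrC (- x) (- r')); lra.
have [r's|r's] := leP r' s.
  by rewrite !greenE// ?(le_trans rr')//; lra.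
rewrite greenC greenE// ?(ltW r's)//.
have [rs|rs] := leP r s.
  by rewrite greenE//; have := ler_wpM2r (ltW (sh _ r0)) (h s r's); lra.
rewrite greenC greenE// ?(ltW rs)//.
have [->|rr] := eqVneq r' r; first by lra.
have := ler_wpM2r (ltW (sh _ s0)) (h r _); rewrite lt_neqAle eq_sym rr rr' => /(_ isT); lra.
Qed.

(** [1 - d^2/dr^2] factors as [(1 - d/dr) (1 + d/dr)]: the kernel [ak] inverts the first factor with
    decay at infinity, its transpose the second with value 0 at the origin. Positive definiteness of
    [green] rests on this. *)
Lemma green_int r s : (\int[mu]_t (ak t r * ak t s)%:E = (green r s)%:E)%E.
Proof.
wlog rs : r s / r <= s.
  move=> H; have [rs|rs] := leP r s; first exact: H.
  rewrite greenC -(H s r (ltW rs)).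
  by apply: eq_integral => t _; rewrite mulrC.
have [r0|r0] := leP r 0.
  rewrite green_le0// integral0_eq// => t _; rewrite /ak.
  by case: ifP => [/andP[t0 tr]|_]; [have := lt_trans t0 tr; rewrite ltNge r0|rewrite mul0r].
pose F t : R := expR (t + t - r - s).
have dF (x : R) : is_derive x 1 (fun t => F t / 2) (F x).
  apply: (is_derive_eq (der_mul (der_exp (der_sub (der_sub (der_add (der_id x) (der_id x)) (der_cst x r))
    (der_cst x s))) (der_cst x _))).
  by rewrite /F; field.
have cF2 : continuous (fun t => F t / 2) by move=> x; exact: der_continuous (dF x).
have cF : continuous F.
  move=> x.
  exact: (der_continuous (der_exp (der_sub (der_sub (der_add (der_id x) (der_id x)) (der_cst x r)) (der_cst x s)))).
transitivity (\int[mu]_(t in `]0%R, r[) (F t)%:E)%E.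
  rewrite [RHS]integral_mkcond; apply: eq_integral => t _.
  rewrite patchE; case: ifPn; rewrite ?inE/= ?notin_setE/= in_itv/=.
    move=> /andP[t0 tr]; rewrite /ak t0 tr (lt_le_trans tr rs)/= -expRD /F.
    by congr (expR _)%:E; ring.
  by move=> /negP; rewrite /ak => /negbTE ->; rewrite mul0r.
rewrite -(@integral_itv_bndoo _ _ _ _ true false); last first.
  by apply/measurable_EFinP/measurable_funTS; exact: continuous_measurable_fun.
rewrite (@continuous_FTC2 _ _ (fun t => F t / 2))//.
- rewrite -EFinB; congr (_%:E); rewrite greenE// /F -mulrBl; congr (_ / _).
  by rewrite mulrBr -!expRD; congr (expR _ - expR _); ring.
- exact: continuous_subspaceT.
- split; first by move=> x _; exact: der_derivable (dF x).
    by apply: cvg_at_right_filter; exact: cF2.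
  by apply: cvg_at_left_filter; exact: cF2.
- by move=> x _; exact: der_derive1 (dF x).
Qed.
End kernel.

(** * The integral operator and its energy form *)

Section iteration.
Variable R : realType.
Local Notation mu := (@lebesgue_measure R).
Implicit Types (r s t C : R) (w z b f g : R -> R).

(* [z := top w] solves [z - z'' = w ^ 3 / r ^ 2], and [Jf w w] is the fourth power
   of the norm of [w] in [L^4(dr / r^2)]. *)
Definition src w r := w r ^+ 3 / r ^+ 2.
(** The a priori class. The bound forces [w r = 0] for [r <= 0], so functions on the half-line are
    handled on the whole line, and it makes the integrals converge through [kap]. *)
Definition cls C w := measurable_fun setT w /\ forall r, 0 <= w r <= C * sg r.
(** Extended-real values let Tonelli's theorem apply before any finiteness is known. *)
Definition Pk f t : \bar R := (\int[mu]_s (ak t s * f s)%:E)%E.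
Definition top w r : R := \int[mu]_s (green r s * src w s).
Definition Jf w z : R := \int[mu]_r (src w r * z r).
Definition K0 : R := \int[mu]_r (kap r).

Lemma cls_ge0 C w r : cls C w -> 0 <= w r.
Proof. by case=> _ /(_ r) /andP[]. Qed.

Lemma cls_le C w r : cls C w -> w r <= C * sg r.
Proof. by case=> _ /(_ r) /andP[]. Qed.

Lemma cls_C0 C w : cls C w -> 0 <= C.
Proof.
case=> _ /(_ 1) /andP[w0 /(le_trans w0)].
by rewrite pmulr_lge0// sg_gt0.
Qed.

Lemma measurable_src C w : cls C w -> measurable_fun setT (src w).
Proof. by case=> mw _; rewrite /src; meas. Qed.

Lemma src_ge0 C w r : cls C w -> 0 <= src w r.
Proof. by move=> cw; rewrite divr_ge0// ?sqr_ge0// exprn_ge0// (cls_ge0 _ cw). Qed.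

Lemma src_sg_le C w r : cls C w -> src w r * sg r <= C ^+ 3 * kap r.
Proof.
move=> cw; rewrite /src /kap mulrAC mulrA ler_wpM2r ?invr_ge0 ?sqr_ge0//.
rewrite [sg r ^+ 4]exprSr mulrA ler_wpM2r ?sg_ge0// -exprMn.
by rewrite lerXn2r ?nnegrE ?(cls_ge0 _ cw) ?(cls_le _ cw)// mulr_ge0 ?sg_ge0// (cls_C0 cw).
Qed.

Lemma src_mul_le C C' w z r : cls C w -> cls C' z ->
  0 <= src w r * z r <= (C ^+ 3 * C') * kap r.
Proof.
move=> cw cz; apply/andP; split.
  by rewrite mulr_ge0 ?(src_ge0 _ cw) ?(cls_ge0 _ cz).
apply: (le_trans (ler_wpM2l (src_ge0 _ cw) (cls_le r cz))).
by have := ler_wpM2l (cls_C0 cz) (src_sg_le r cw); lra.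
Qed.

Lemma measurable_srcM C C' w z : cls C w -> cls C' z ->
  measurable_fun setT (fun r => src w r * z r).
Proof. by move=> cw [mz _]; have ms := measurable_src cw; meas. Qed.

Lemma integrable_srcM C C' w z : cls C w -> cls C' z ->
  mu.-integrable setT (EFin \o (fun r => src w r * z r)).
Proof.
move=> cw cz; apply: (@integrable_dominated _ _ _ mu _ (fun r => (C ^+ 3 * C') * kap r)).
- exact: measurable_srcM cw cz.
- by move=> r; have /andP[h1 h2] := src_mul_le r cw cz; rewrite ger0_norm.
- by apply: integrableZ; exact: integrable_kap.
Qed.

Lemma EFin_Jf C C' w z : cls C w -> cls C' z ->
  ((Jf w z)%:E = \int[mu]_r (src w r * z r)%:E)%E.
Proof.
by move=> cw cz; rewrite fineK//; apply: integrable_fin_num => //; exact: integrable_srcM cw cz.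
Qed.

Lemma green_src_le C w r s : cls C w ->
  0 <= green r s * src w s <= (C ^+ 3 * sg r) * kap s.
Proof.
move=> cw; apply/andP; split.
  by rewrite mulr_ge0 ?(src_ge0 _ cw) ?green_ge0.
apply: (le_trans (ler_wpM2r (src_ge0 s cw) (green_le r s))).
by have := ler_wpM2l (sg_ge0 r) (src_sg_le s cw); lra.
Qed.

Lemma measurable_green_src C w : cls C w ->
  measurable_fun setT (fun x : R * R => green x.1 x.2 * src w x.2).
Proof.
move=> cw; apply: measurable_funM; first exact: measurable_green.
by apply: (measurableT_comp (measurable_src cw)); exact: measurable_snd.
Qed.

Lemma integrable_green_src C w r : cls C w ->
  mu.-integrable setT (EFin \o (fun s => green r s * src w s)).
Proof.
move=> cw; apply: (@integrable_dominated _ _ _ mu _ (fun s => (C ^+ 3 * sg r) * kap s)).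
- exact: (measurableT_comp (measurable_green_src cw) (@pair1_measurable _ _ _ _ r)).
- by move=> s; have /andP[h1 h2] := green_src_le r s cw; rewrite ger0_norm.
- by apply: integrableZ; exact: integrable_kap.
Qed.

Lemma EFin_top C w r : cls C w ->
  ((top w r)%:E = \int[mu]_s (green r s * src w s)%:E)%E.
Proof.
by move=> cw; rewrite fineK//; apply: integrable_fin_num => //; exact: integrable_green_src cw.
Qed.

Lemma cls_top C w : cls C w -> cls (C ^+ 3 * K0) (top w).
Proof.
move=> cw; split.
  apply/measurable_EFinP.
  have -> : EFin \o top w = fun r => (\int[mu]_s (green r s * src w s)%:E)%E.
    by apply/funext => r /=; rewrite (EFin_top _ cw).
  apply: (@measurable_fun_fubini_tonelli_F _ _ _ _ _ mu
    (fun x : R * R => (green x.1 x.2 * src w x.2)%:E)).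
  - by apply/measurable_EFinP; exact: measurable_green_src cw.
  - by move=> x; rewrite lee_fin; have /andP[] := green_src_le x.1 x.2 cw.
move=> r; apply/andP; split.
  by apply: Rintegral_ge0 => s _; have /andP[] := green_src_le r s cw.
rewrite mulrAC -[leRHS](@RintegralZl _ _ _ mu)//; last exact: integrable_kap.
apply: le_Rintegral => //.
- exact: integrable_green_src cw.
- by apply: integrableZ; exact: integrable_kap.
- by move=> s _; have /andP[] := green_src_le r s cw.
Qed.

Lemma measurable_Pk f : measurable_fun setT f -> (forall s, 0 <= f s) ->
  measurable_fun setT (Pk f).
Proof.
move=> mf f0; apply: (@measurable_fun_fubini_tonelli_F _ _ _ _ _ mu
    (fun x : R * R => (ak x.1 x.2 * f x.2)%:E)).
- apply/measurable_EFinP; apply: measurable_funM; first exact: measurable_ak.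
  by apply: (measurableT_comp mf); exact: measurable_snd.
- by move=> x; rewrite lee_fin mulr_ge0// ak_ge0.
Qed.

Lemma Pk_ge0 f t : (forall s, 0 <= f s) -> (0 <= Pk f t)%E.
Proof. by move=> f0; apply: integral_ge0 => s _; rewrite lee_fin mulr_ge0// ak_ge0. Qed.

Lemma measurable_ak1 r : measurable_fun setT (ak r).
Proof. exact: (measurableT_comp (@measurable_ak R) (@pair1_measurable _ _ _ _ r)). Qed.

Lemma measurable_ak2 r : measurable_fun setT (fun t => ak t r).
Proof. exact: (measurableT_comp (@measurable_ak R) (@pair2_measurable _ _ _ _ r)). Qed.

Lemma measurable_ak_swap : measurable_fun setT (fun x : R * R => ak x.2 x.1).
Proof.
apply: (measurableT_comp (@measurable_ak R) (g := fun x : R * R => (x.2, x.1))).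
exact: measurable_fun_pair.
Qed.

Lemma green_Pk f r : measurable_fun setT f -> (forall s, 0 <= f s) ->
  (\int[mu]_s (green r s * f s)%:E = \int[mu]_t ((ak t r)%:E * Pk f t))%E.
Proof.
move=> mf f0.
transitivity (\int[mu]_s \int[mu]_t (ak t r * ak t s * f s)%:E)%E.
  apply: eq_integral => s _; rewrite EFinM -green_int -ge0_integralZr//.
  - apply/measurable_EFinP; apply: measurable_funM; exact: measurable_ak2.
  - by move=> t _; rewrite lee_fin mulr_ge0// ak_ge0.
  - by rewrite lee_fin.
rewrite (@fubini_tonelli _ _ _ _ _ mu mu (fun x : R * R => (ak x.2 r * ak x.2 x.1 * f x.1)%:E))/=.
- apply: eq_integral => t _; rewrite /Pk -ge0_integralZl//.
  + by apply: eq_integral => s _; rewrite -EFinM mulrA.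
  + by apply/measurable_EFinP; apply: measurable_funM => //; exact: measurable_ak1.
  + by move=> s _; rewrite lee_fin mulr_ge0// ak_ge0.
  + by rewrite lee_fin ak_ge0.
- apply/measurable_EFinP; apply: measurable_funM; last exact: measurableT_comp.
  apply: measurable_funM; last exact: measurable_ak_swap.
  exact: (measurableT_comp (measurable_ak2 r)).
- by move=> x; rewrite lee_fin !mulr_ge0// ak_ge0.
Qed.

(** Tonelli's theorem after inserting the square root of the kernel: the energy form becomes an L^2
    inner product, in which squares can be completed. *)
Lemma Jf_top_quadratic C C' w b : cls C w -> cls C' b ->
  ((Jf b (top w))%:E = \int[mu]_t (Pk (src b) t * Pk (src w) t))%E.
Proof.
move=> cw cb; rewrite (EFin_Jf cb (cls_top cw)).
have mw := measurable_src cw; have mb := measurable_src cb.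
have w0 s := src_ge0 s cw; have b0 s := src_ge0 s cb.
transitivity (\int[mu]_r \int[mu]_t ((src b r * ak t r)%:E * Pk (src w) t))%E.
  apply: eq_integral => r _; rewrite EFinM (EFin_top _ cw) green_Pk// -ge0_integralZl//.
  - by apply: eq_integral => t _; rewrite EFinM muleA.
  - apply: emeasurable_funM; last exact: measurable_Pk.
    by apply/measurable_EFinP; exact: measurable_ak2.
  - by move=> t _; rewrite mule_ge0 ?Pk_ge0// lee_fin ak_ge0.
  - by rewrite lee_fin.
rewrite (@fubini_tonelli _ _ _ _ _ mu mu (fun x : R * R => ((src b x.1 * ak x.2 x.1)%:E * Pk (src w) x.2)%E))/=.
- apply: eq_integral => t _; rewrite ge0_integralZr//.
  + by congr (_ * _)%E; apply: eq_integral => s _; rewrite mulrC.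
  + by apply/measurable_EFinP; apply: measurable_funM => //; exact: measurable_ak1.
  + by move=> s _; rewrite lee_fin mulr_ge0// ak_ge0.
  + exact: Pk_ge0.
- apply: emeasurable_funM; last exact: (measurableT_comp (measurable_Pk mw w0)).
  apply/measurable_EFinP; apply: measurable_funM; first exact: measurableT_comp.
  exact: measurable_ak_swap.
- by move=> x; rewrite mule_ge0 ?Pk_ge0// lee_fin mulr_ge0// ak_ge0.
Qed.

Lemma ereal_AMGM (x y : \bar R) : (0 <= x -> 0 <= y -> 2%:E * (x * y) <= x * x + y * y)%E.
Proof.
move: x y => [x| |] [y| |]//=; rewrite ?lee_fin => x0 y0.
- by have := sqr_ge0 (x - y); nra.
- by rewrite mulyy addey// leey.
- by rewrite mulyy addye// leey.
- by rewrite mulyy addye// leey.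
Qed.

(** Nonnegativity of the squared L^2 norm of [Pk (src w) - Pk (src b)], obtained from the pointwise
    [2 x y <= x^2 + y^2] so that no possibly infinite values are subtracted. *)
Lemma Jf_top_polarized_le C C' w b : cls C w -> cls C' b ->
  2 * Jf b (top w) <= Jf w (top w) + Jf b (top b).
Proof.
move=> cw cb.
have q1 : ((2 * Jf b (top w))%:E = 2 * \int[mu]_t (Pk (src b) t * Pk (src w) t))%E.
  by rewrite -(Jf_top_quadratic cw cb) EFinM.
have q2 : ((Jf w (top w) + Jf b (top b))%:E = \int[mu]_t (Pk (src w) t * Pk (src w) t) +
    \int[mu]_t (Pk (src b) t * Pk (src b) t))%E.
  by rewrite -(Jf_top_quadratic cw cw) -(Jf_top_quadratic cb cb) EFinD.
rewrite -lee_fin q1 q2.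
have mw := measurable_src cw; have mb := measurable_src cb.
have w0 s := src_ge0 s cw; have b0 s := src_ge0 s cb.
have mPw := measurable_Pk mw w0; have mPb := measurable_Pk mb b0.
rewrite -ge0_integralZl//; last 2 first.
- exact: emeasurable_funM.
- by move=> t _; rewrite mule_ge0// Pk_ge0.
rewrite -ge0_integralD//; last 4 first.
- by move=> t _; rewrite mule_ge0// Pk_ge0.
- exact: emeasurable_funM.
- by move=> t _; rewrite mule_ge0// Pk_ge0.
- exact: emeasurable_funM.
apply: ge0_le_integral => //.
- by move=> t _; rewrite mule_ge0// mule_ge0// Pk_ge0.
- by apply: measurable_funeM; exact: emeasurable_funM.
- by apply: emeasurable_funD; exact: emeasurable_funM.
- by move=> t _; rewrite addeC; apply: ereal_AMGM; exact: Pk_ge0.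
Qed.

(** Cauchy-Schwarz: [top w r] is the inner product of [ak t r] and [Pk (src w)], whose squared norms
    are [green r r] and the energy. Since [w] enters only through its energy, the bound can be
    uniform along the iteration. *)
Lemma top_sqr_le C w r : cls C w -> 0 < Jf w (top w) ->
  top w r ^+ 2 <= sg r ^+ 2 * Jf w (top w).
Proof.
move=> cw E0; set E := Jf _ _ in E0 *.
have mw := measurable_src cw; have w0 s := src_ge0 s cw.
have mPw := measurable_Pk mw w0.
have ctw := cls_top cw.
have H th : 0 <= th -> 2 * (th * top w r) <= sg r ^+ 2 + th ^+ 2 * E.
  move=> th0; apply: (@le_trans _ _ (green r r + th ^+ 2 * E)); last by rewrite lerD2r green_diag.
  rewrite -lee_fin [(2 * _)%:E]EFinM [(th * _)%:E]EFinM [(green r r + _)%:E]EFinD.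
  rewrite [(th ^+ 2 * E)%:E]EFinM (EFin_top _ cw) green_Pk// /E (Jf_top_quadratic cw cw) -green_int.
  have me : measurable_fun setT (fun t => (ak t r)%:E * Pk (src w) t)%E.
    by apply: emeasurable_funM => //; apply/measurable_EFinP; exact: measurable_ak2.
  have ge t : (0 <= (ak t r)%:E * Pk (src w) t)%E by rewrite mule_ge0 ?Pk_ge0// lee_fin ak_ge0.
  have -> : (th%:E * \int[mu]_t ((ak t r)%:E * Pk (src w) t) =
      \int[mu]_t (th%:E * ((ak t r)%:E * Pk (src w) t)))%E.
    by rewrite ge0_integralZl// lee_fin.
  have -> : (2 * \int[mu]_t (th%:E * ((ak t r)%:E * Pk (src w) t)) =
      \int[mu]_t (2 * (th%:E * ((ak t r)%:E * Pk (src w) t))))%E.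
    have m2 : measurable_fun setT (fun t => th%:E * ((ak t r)%:E * Pk (src w) t))%E.
      exact: measurable_funeM.
    have g2 t : (0 <= th%:E * ((ak t r)%:E * Pk (src w) t))%E by rewrite mule_ge0 ?lee_fin.
    by rewrite [RHS]ge0_integralZl.
  have -> : ((th ^+ 2)%:E * \int[mu]_t (Pk (src w) t * Pk (src w) t) =
      \int[mu]_t ((th ^+ 2)%:E * (Pk (src w) t * Pk (src w) t)))%E.
    rewrite ge0_integralZl//; first exact: emeasurable_funM.
      by move=> t _; rewrite mule_ge0// Pk_ge0.
    by rewrite lee_fin sqr_ge0.
  rewrite -ge0_integralD//; last 4 first.
  - by move=> t _; rewrite lee_fin mulr_ge0// ak_ge0.
  - by apply/measurable_EFinP; apply: measurable_funM; exact: measurable_ak2.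
  - by move=> t _; rewrite mule_ge0// ?mule_ge0 ?Pk_ge0// lee_fin sqr_ge0.
  - by apply: measurable_funeM; exact: emeasurable_funM.
  apply: ge0_le_integral => //.
  - by move=> t _; rewrite mule_ge0// mule_ge0// lee_fin.
  - by apply: measurable_funeM; exact: measurable_funeM.
  - apply: emeasurable_funD; first by apply/measurable_EFinP; apply: measurable_funM; exact: measurable_ak2.
    by apply: measurable_funeM; exact: emeasurable_funM.
  - move=> t _.
    have := @ereal_AMGM (ak t r)%:E (th%:E * Pk (src w) t)%E.
    rewrite lee_fin ak_ge0 => /(_ isT); rewrite mule_ge0 ?Pk_ge0 ?lee_fin// => /(_ isT).
    by rewrite [((ak t r)%:E * (th%:E * _))%E]muleCA [(th%:E * _ * _)%E]muleACA -!EFinM -expr2.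
(* This parameter maximises [2 * th * top w r - th ^+ 2 * E]. *)
have := H (top w r / E); rewrite divr_ge0 ?(cls_ge0 _ ctw) ?(ltW E0)// => /(_ isT).
have -> : 2 * (top w r / E * top w r) = 2 * (top w r ^+ 2 / E) by field; rewrite gt_eqF.
have -> : (top w r / E) ^+ 2 * E = top w r ^+ 2 / E by field; rewrite gt_eqF.
by rewrite -ler_pdivrMr//; lra.
Qed.

Lemma src_scale w c r : src (fun x => c * w x) r = c ^+ 3 * src w r.
Proof. by rewrite /src exprMn mulrA. Qed.

Lemma cls_scale C w c : 0 <= c -> cls C w -> cls (c * C) (fun x => c * w x).
Proof.
move=> c0 [mw wC]; split; first by meas.
by move=> r; have /andP[h1 h2] := wC r; rewrite mulr_ge0//= -mulrA ler_wpM2l.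
Qed.

Lemma Jf_scalel C C' w z c : cls C w -> cls C' z ->
  Jf (fun x => c * w x) z = c ^+ 3 * Jf w z.
Proof.
move=> cw cz; rewrite /Jf -RintegralZl//; last exact: integrable_srcM cw cz.
by apply: eq_Rintegral => s _; rewrite src_scale mulrA.
Qed.

Lemma Jf_scaler C C' w z c : cls C w -> cls C' z ->
  Jf w (fun x => c * z x) = c * Jf w z.
Proof.
move=> cw cz; rewrite /Jf -RintegralZl//; last exact: integrable_srcM cw cz.
by apply: eq_Rintegral => s _; rewrite mulrCA.
Qed.

(** Young's inequality [4 a^3 b <= 3 a^4 + b^4] with its exact defect. The second factor vanishes
    only for [a = b = 0], so equality forces [a = b]. *)
Lemma young_identity (a b : R) :
  3 * a ^+ 4 + b ^+ 4 - 4 * (a ^+ 3 * b) = (a - b) ^+ 2 * (2 * a ^+ 2 + (a + b) ^+ 2).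
Proof. by ring. Qed.

Lemma Jf_young C C' w b : cls C w -> cls C' b ->
  4 * Jf w b <= 3 * Jf w w + Jf b b.
Proof.
move=> cw cb.
have iwb := integrable_srcM cw cb; have iww := integrable_srcM cw cw; have ibb := integrable_srcM cb cb.
rewrite /Jf -!RintegralZl// -RintegralD//; last exact: integrableZ.
apply: le_Rintegral => //; [exact: integrableZ| |].
  by apply: (integrableD measurableT (integrableZ 3 iww) ibb).
move=> r _; rewrite /src.
have := young_identity (w r) (b r).
move=> h; rewrite -subr_ge0.
have -> : 3 * (w r ^+ 3 / r ^+ 2 * w r) + b r ^+ 3 / r ^+ 2 * b r - 4 * (w r ^+ 3 / r ^+ 2 * b r) =
  (3 * w r ^+ 4 + b r ^+ 4 - 4 * (w r ^+ 3 * b r)) / r ^+ 2 by ring.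
by rewrite h divr_ge0 ?sqr_ge0// mulr_ge0 ?sqr_ge0// addr_ge0 ?sqr_ge0// mulr_ge0 ?sqr_ge0.
Qed.

Lemma Jf_ge0 C C' w b : cls C w -> cls C' b -> 0 <= Jf w b.
Proof.
by move=> cw cb; apply: Rintegral_ge0 => r _; have /andP[] := src_mul_le r cw cb.
Qed.

(** If the integral vanished, [src w] would be 0 almost everywhere on [r > 0], where [h] is
    positive, and [Jf w w] would be 0. *)
Lemma integral_src_neq0 C w (h : R -> R) : cls C w -> 0 < Jf w w ->
  measurable_fun setT h -> (forall r, 0 <= h r) -> (forall r, 0 < r -> 0 < h r) ->
  (\int[mu]_r (src w r * h r)%:E != 0)%E.
Proof.
move=> cw J0 mh h0 hpos; apply/eqP => I0.
have msw := measurable_src cw.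
have mf : measurable_fun setT (fun r => (src w r * h r)%:E).
  by apply/measurable_EFinP; exact: measurable_funM.
have /ae_eq_integral_abs : (\int[mu]_r `|(src w r * h r)%:E| = 0)%E.
  rewrite -[RHS]I0; apply: eq_integral => r _.
  by rewrite gee0_abs// lee_fin mulr_ge0// (src_ge0 _ cw).
move=> /(_ measurableT mf) ae0.
suff : Jf w w = 0 by move=> JE; rewrite JE ltxx in J0.
rewrite /Jf /Rintegral (@ge0_ae_eq_integral _ _ _ mu setT _ (cst 0%E)) ?integral0//.
- by apply/measurable_EFinP; exact: (measurable_srcM cw cw).
- by move=> r _; rewrite lee_fin; have /andP[] := src_mul_le r cw cw.
- apply: filterS ae0 => r /(_ I) /= [] + _ => /eqP.
  have [r0|r0] := leP r 0.
    have -> : w r = 0.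
      apply/eqP; rewrite eq_le (cls_ge0 _ cw) andbT.
      by apply: (le_trans (cls_le _ cw)); rewrite sg_le0// mulr0.
    by rewrite mulr0.
  by rewrite mulf_eq0 (gt_eqF (hpos _ r0)) orbF => /eqP ->; rewrite mul0r.
Qed.

Lemma top_gt0 C w r : cls C w -> 0 < Jf w w -> 0 < r -> 0 < top w r.
Proof.
move=> cw J0 r0; have ctw := cls_top cw.
rewrite lt_neqAle (cls_ge0 _ ctw) andbT eq_sym; apply/eqP => T0.
have := @integral_src_neq0 _ _ (green r) cw J0.
have -> : (\int[mu]_r0 (src w r0 * green r r0)%:E = 0)%E.
  rewrite -[RHS](congr1 EFin T0) (EFin_top _ cw).
  by apply: eq_integral => s _; rewrite mulrC.
rewrite eqxx => H; suff : false by [].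
apply: H.
- exact: (measurableT_comp (@measurable_green R) (@pair1_measurable _ _ _ _ r)).
- by move=> s; exact: green_ge0.
- by move=> s s0; exact: green_gt0.
Qed.

Lemma Jf_top_gt0 C w : cls C w -> 0 < Jf w w -> 0 < Jf w (top w).
Proof.
move=> cw J0; have ctw := cls_top cw.
rewrite lt_neqAle (Jf_ge0 cw ctw) andbT eq_sym; apply/eqP => T0.
have := @integral_src_neq0 _ _ (top w) cw J0.
rewrite -(EFin_Jf cw ctw) T0 eqxx => H; suff : false by [].
apply: H; first by case: ctw.
- by move=> s; exact: cls_ge0 ctw.
- by move=> s s0; exact: top_gt0 cw J0 s0.
Qed.

(** Otherwise Young's inequality for [w] and [top w] divided by the energy would read [4 <= 3]. This
    permits the normalisation of [top w]. *)
Lemma Jf_top_top_gt0 C w : cls C w -> Jf w w = 1 -> 0 < Jf (top w) (top w).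
Proof.
move=> cw J1; have ctw := cls_top cw.
have E0 : 0 < Jf w (top w) by apply: (Jf_top_gt0 cw); rewrite J1.
rewrite lt_neqAle (Jf_ge0 ctw ctw) andbT eq_sym; apply/eqP => T0.
have dE : 0 <= (Jf w (top w))^-1 by rewrite invr_ge0 ltW.
have cb := cls_scale dE ctw.
have := Jf_young cw cb.
rewrite (Jf_scaler _ cw ctw) (Jf_scaler _ cb ctw) (Jf_scalel _ ctw ctw) T0 !mulr0 J1.
by rewrite mulVf ?gt_eqF//; lra.
Qed.
End iteration.

(** * The normalised power iteration and its uniform bounds *)

Section power_iteration.
Variable R : realType.
Local Notation mu := (@lebesgue_measure R).
Implicit Types (r s t C : R) (w z b f g : R -> R).

(** The norm of [top w] in [L^4(dr / r^2)], the fourth root being taken as two square roots. *)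
Definition nu w : R := Num.sqrt (Num.sqrt (Jf (top w) (top w))).
Definition step w r := (nu w)^-1 * top w r.
Definition En w := Jf w (top w).
Definition norm1 w := (exists C, cls C w) /\ Jf w w = 1.
Definition sh r : R := expR r - expR (- r).

Lemma nu_gt0 w : norm1 w -> 0 < nu w.
Proof.
by move=> [[C cw] w1]; rewrite !sqrtr_gt0; exact: Jf_top_top_gt0 cw w1.
Qed.

Lemma nu4 w : norm1 w -> nu w ^+ 4 = Jf (top w) (top w).
Proof.
move=> [[C cw] w1]; rewrite (_ : 4 = 2 * 2)%N// exprM sqr_sqrtr ?sqrtr_ge0//.
by rewrite sqr_sqrtr// ltW// (Jf_top_top_gt0 cw w1).
Qed.

Lemma En_gt0 w : norm1 w -> 0 < En w.
Proof. by move=> [[C cw] w1]; apply: (Jf_top_gt0 cw); rewrite w1. Qed.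

Lemma norm1_step w : norm1 w -> norm1 (step w).
Proof.
move=> nw; have n0 := nu_gt0 nw; have n4 := nu4 nw; case: nw => -[C cw] w1.
have ct := cls_top cw; have n0' : 0 <= (nu w)^-1 by rewrite invr_ge0 ltW.
have cs : cls _ (step w) := cls_scale n0' ct.
split; first by exists ((nu w)^-1 * (C ^+ 3 * K0 R)).
rewrite /step (Jf_scalel _ ct cs) (Jf_scaler _ ct ct) -n4.
by rewrite mulrA -exprSr -exprMn mulVf ?gt_eqF// expr1n.
Qed.

(** Hölder's inequality for [w] and [top w], in the form of Young's inequality for the two unit
    functions [w] and [step w]. *)
Lemma En_le_nu w : norm1 w -> En w <= nu w.
Proof.
move=> nw; have n0 := nu_gt0 nw; have [_ s1] := norm1_step nw; case: nw => -[C cw] w1.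
have ct := cls_top cw; have n0' : 0 <= (nu w)^-1 by rewrite invr_ge0 ltW.
have cs : cls _ (step w) := cls_scale n0' ct.
have := Jf_young cw cs; rewrite s1 w1 (Jf_scaler _ cw ct) -/(En w) => h.
have : (nu w)^-1 * En w <= 1 by lra.
by rewrite mulrC ler_pdivrMr// mul1r.
Qed.

(** Positive definiteness at [w] and [step w], where the mixed term is [nu w ^- 3 * nu w ^+ 4].
    Together with [En_le_nu] it interlaces: [En w <= nu w <= En (step w)]. *)
Lemma nu_le w : norm1 w -> 2 * nu w <= En w + En (step w).
Proof.
move=> nw; have n0 := nu_gt0 nw; have n4 := nu4 nw; case: nw => -[C cw] w1.
have ct := cls_top cw; have n0' : 0 <= (nu w)^-1 by rewrite invr_ge0 ltW.
have cs : cls _ (step w) := cls_scale n0' ct.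
have := Jf_top_polarized_le cw cs; rewrite -/(En w) -/(En (step w)); suff -> : Jf (step w) (top w) = nu w by [].
rewrite (Jf_scalel _ ct ct) -n4 exprVn.
by field; rewrite gt_eqF.
Qed.

Lemma top_le w r : norm1 w -> top w r <= Num.sqrt (En w) * sg r.
Proof.
move=> nw; have E0 := En_gt0 nw; case: nw => -[C cw] w1.
rewrite -(ler_sqr (cls_ge0 r (cls_top cw))) ?nnegrE ?mulr_ge0 ?sqrtr_ge0 ?sg_ge0//.
by rewrite exprMn sqr_sqrtr ?(ltW E0)// mulrC; exact: top_sqr_le cw E0.
Qed.

Lemma cls_topE w : norm1 w -> cls (Num.sqrt (En w)) (top w).
Proof.
move=> nw; have := top_le _ nw; case: nw => -[C cw] w1 h.
have ct := cls_top cw; split; first by case: ct.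
by move=> r; rewrite (cls_ge0 _ ct) h.
Qed.

(** The natural constant [sqrt (En w) / nu w] is at most [1 / sqrt (En w)], as [En w <= nu w]. A
    lower bound [e] for all the energies thus puts all iterates in one class. *)
Lemma cls_step e w : norm1 w -> 0 < e -> e <= En w -> cls (Num.sqrt e)^-1 (step w).
Proof.
move=> nw e0 eE; have n0 := nu_gt0 nw; have E0 := En_gt0 nw.
have ct := cls_topE nw; have n0' : 0 <= (nu w)^-1 by rewrite invr_ge0 ltW.
have [ms cs] : cls _ (step w) := cls_scale n0' ct.
split=> // r; have /andP[-> /= /le_trans] := cs r; apply.
rewrite ler_wpM2r ?sg_ge0// mulrC ler_pdivrMr// mulrC ler_pdivlMr ?sqrtr_gt0//.
rewrite (le_trans _ (En_le_nu nw))// -[leRHS](sqr_sqrtr (ltW E0)) expr2.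
by rewrite ler_wpM2l ?sqrtr_ge0// ler_wsqrtr.
Qed.

Lemma Jf_le C w : cls C w -> Jf w w <= C ^+ 4 * K0 R.
Proof.
move=> cw; rewrite -RintegralZl//; last exact: integrable_kap.
apply: le_Rintegral => //; first exact: (integrable_srcM cw cw).
  by apply: integrableZ; exact: integrable_kap.
by move=> r _; rewrite exprSr; have /andP[] := src_mul_le r cw cw.
Qed.

(** Bounds the increasing energies: [nu w ^+ 4 <= En w ^+ 2 * K0 <= nu w ^+ 2 * K0]. *)
Lemma nu_sqr_le w : norm1 w -> nu w ^+ 2 <= K0 R.
Proof.
move=> nw; have n0 := nu_gt0 nw; have E0 := En_gt0 nw.
have K00 : 0 <= K0 R by apply: Rintegral_ge0 => r _; exact: kap_ge0.
have h : (nu w ^+ 2) ^+ 2 <= En w ^+ 2 * K0 R.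
  have := Jf_le (cls_topE nw); rewrite -(nu4 nw) (_ : 4 = 2 * 2)%N// !exprM.
  by rewrite [X in X ^+ 2 * K0 R]sqr_sqrtr// (ltW E0).
have h2 : En w ^+ 2 <= nu w ^+ 2.
  by rewrite ler_sqr ?nnegrE ?(ltW E0) ?(ltW n0)// En_le_nu.
have := le_trans h (ler_wpM2r K00 h2).
by rewrite expr2 ler_pM2l ?exprn_gt0.
Qed.

(** Transfers the two shape inequalities from the kernel to [top w] by integrating against the
    nonnegative [src w]. *)
Lemma top_mono C w (a b r r' : R) : cls C w ->
  (forall s, a * green r s <= b * green r' s) -> a * top w r <= b * top w r'.
Proof.
move=> cw h.
have i1 := integrable_green_src r cw; have i2 := integrable_green_src r' cw.
have -> : a * top w r = \int[mu]_s (a * (green r s * src w s)) by rewrite RintegralZl.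
have -> : b * top w r' = \int[mu]_s (b * (green r' s * src w s)) by rewrite RintegralZl.
apply: (le_Rintegral measurableT (integrableZ a i1) (integrableZ b i2)) => s _.
by have := ler_wpM2r (src_ge0 s cw) (h s); rewrite -!mulrA.
Qed.

Lemma step_expR w r r' : norm1 w -> r <= r' -> expR r * step w r <= expR r' * step w r'.
Proof.
move=> nw rr'; have n0 := nu_gt0 nw; case: nw => -[C cw] w1.
have h : expR r * top w r <= expR r' * top w r'.
  by apply: (top_mono cw) => s; exact: green_expR_nd.
have n0' : 0 <= (nu w)^-1 by rewrite invr_ge0 ltW.
rewrite /step; move: (top w r) (top w r') (nu w)^-1 n0' h => x y k k0 h.
by rewrite !(mulrCA _ k) ler_wpM2l.
Qed.

Lemma step_sh w r r' : norm1 w -> 0 < r -> r <= r' ->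
  sh r * step w r' <= sh r' * step w r.
Proof.
move=> nw r0 rr'; have n0 := nu_gt0 nw; case: nw => -[C cw] w1.
have h : sh r * top w r' <= sh r' * top w r.
  apply: (top_mono cw) => s.
  by rewrite mulrC (mulrC (sh r')); exact: green_sinh_ni.
have n0' : 0 <= (nu w)^-1 by rewrite invr_ge0 ltW.
rewrite /step; move: (top w r) (top w r') (nu w)^-1 n0' h => x y k k0 h.
by rewrite !(mulrCA _ k) ler_wpM2l.
Qed.

Lemma K0_gt0 : 0 < K0 R.
Proof.
have ik := integrable_kap R.
apply: (@lt_le_trans _ _ (4^-1)); first by rewrite invr_gt0.
rewrite -lee_fin fineK; last exact: integrable_fin_num.
apply: (@le_trans _ _ (\int[mu]_(x in `[1%R, 2%R]) (4^-1)%:E)%E).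
  rewrite integral_cst//= lebesgue_measure_itv/= lte_fin ltr1n -EFinB -EFinM lee_fin.
  by rewrite (_ : 2 - 1 = 1 :> R) ?mulr1//; lra.
apply: (@le_trans _ _ (\int[mu]_(x in `[1%R, 2%R]) (kap x)%:E)%E).
  apply: ge0_le_integral => //.
  - by apply/measurable_EFinP/measurable_funTS; exact: measurable_kap.
  - move=> x /=; rewrite in_itv/= => /andP[x1 x2]; rewrite lee_fin /kap /sg min_r//.
    rewrite sqrtr1 expr1n mul1r lef_pV2 ?posrE ?exprn_gt0//; last by lra.
    rewrite (_ : 4 = 2 ^+ 2 :> R); last by ring.
    by rewrite lerXn2r ?nnegrE// (le_trans ler01 x1).
apply: ge0_subset_integral => //.
- by apply/measurable_EFinP; exact: measurable_kap.
- by move=> x _; rewrite lee_fin kap_ge0.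
Qed.

(** The iteration starts from a multiple of [sg], for which [Jf sg sg] is exactly [K0]. *)
Lemma exists_norm1 : exists w, norm1 w.
Proof.
have K := K0_gt0; set k := (Num.sqrt (Num.sqrt (K0 R)))^-1.
have k0 : 0 <= k by rewrite invr_ge0 sqrtr_ge0.
have c1 : cls 1 (@sg R).
  by split; [exact: measurable_sg|move=> r; rewrite mul1r sg_ge0/=].
have ck := cls_scale k0 c1.
exists (fun r => k * sg r); split; first by exists (k * 1).
rewrite (Jf_scalel _ c1 ck) (Jf_scaler _ c1 c1).
have -> : Jf (@sg R) (@sg R) = K0 R.
  by apply: eq_Rintegral => r _; rewrite /src /kap mulrAC -exprSr.
rewrite mulrA -exprSr exprVn (_ : 4 = 2 * 2)%N// exprM !sqr_sqrtr ?sqrtr_ge0 ?(ltW K)//.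
by rewrite mulVf// gt_eqF.
Qed.

End power_iteration.

(** * Pointwise convergent subsequences *)

Section extraction.
Variable R : realType.
Implicit Types (r s C : R).

Lemma sh_gt0 r : 0 < r -> 0 < sh r.
Proof. by move=> r0; rewrite /sh subr_gt0 ltr_expR; lra. Qed.

(* Inherited from [green _ s]; it gives a modulus of continuity on [r > 0] that is
   uniform over all bounded [shaped] functions. *)
Definition shaped (w : R -> R) := (forall r r', r <= r' -> expR r * w r <= expR r' * w r') /\
  (forall r r', 0 < r -> r <= r' -> sh r * w r' <= sh r' * w r).

(** The two monotonicities squeeze [w r] between [w q * expR (q - r)] and [w q * sh r / sh q]. The
    width of this interval is at most [F q], and [F] is continuous with [F r = 0]. A rational [q]
    reduces convergence to countably many values. *)
Lemma shaped_near r (C e : R) : 0 < r -> 0 <= C -> 0 < e -> exists q : rat,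
  [/\ 0 < ratr q :> R, ratr q <= r & forall w, shaped w ->
    0 <= w (ratr q) <= C -> `|w (ratr q) - w r| <= e].
Proof.
move=> r0 C0 e0.
pose F (x : R) := C * (sh r / sh x - expR (x - r)).
have F0 : F r = 0 by rewrite /F divff ?gt_eqF ?sh_gt0// subrr expR0 subrr mulr0.
have cF : {for r, continuous F}.
  have dsh : is_derive r 1 (@sh R) _ := der_sub (der_exp (der_id r)) (der_exp (der_opp (der_id r))).
  have sn0 : sh r != 0 by rewrite gt_eqF// sh_gt0.
  exact: (der_continuous (der_mul (der_cst r C) (der_sub (der_div sn0 (der_cst r (sh r)) dsh) (der_exp (der_sub (der_id r) (der_cst r r)))))).
move: cF; rewrite /prop_for/= /continuous_at F0 => /cvgrPdist_lt /(_ _ e0) [d /= d0 dF].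
have mr : Num.max 0 (r - d) < r by rewrite gt_max r0/=; lra.
have [q] := rat_in_itvoo mr.
rewrite in_itv/= gt_max => /andP[/andP[q0 qd] qr].
exists q; split=> //; first exact: ltW.
move=> w [we ws] /andP[w0 wC].
have : `|0 - F (ratr q)| < e by apply: dF; rewrite /= gtr0_norm; lra.
rewrite sub0r normrN => Fe; have {Fe} : F (ratr q) < e by exact: le_lt_trans (ler_norm _) Fe.
move=> FE.
have h1 : w (ratr q) * expR (ratr q - r) <= w r.
  have := we _ _ (ltW qr); rewrite expRD mulrA expRN ler_pdivrMr ?expR_gt0//.
  by rewrite mulrC (mulrC (w r)).
have h2 : w r <= w (ratr q) * (sh r / sh (ratr q)).
  have := ws _ _ q0 (ltW qr); rewrite mulrA ler_pdivlMr ?sh_gt0//.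
  by move=> ?; lra.
have a1 : expR (ratr q - r) <= 1 by rewrite -[leRHS]expR0 ler_expR; lra.
have a2 : 1 <= sh r / sh (ratr q).
  rewrite ler_pdivlMr ?sh_gt0// mul1r /sh lerB// ler_expR; lra.
move: FE; rewrite /F; set x := w _ in w0 wC h1 h2 *; set A := _ / _ in h2 a2 *; set B := expR _ in h1 a1 *.
move=> CAB; have : x * (A - B) <= C * (A - B) by rewrite ler_wpM2r//; lra.
have p1 : x * B <= x by rewrite ler_piMr.
have p2 : x <= x * A by rewrite ler_peMr.
by move=> h; rewrite ler_norml; apply/andP; split; lra.
Qed.

(** Selection in the manner of Helly. Restrictions to the rationals live in a product of segments,
    compact by Tychonoff's theorem, so they have a cluster point [c]. The index [ph k], taken past
    [k], approximates [c] within [1 / k.+1] at the rationals of code at most [k]. *)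
Lemma shaped_cvg_subsequence C (v : nat -> R -> R) : (forall n, shaped (v n)) ->
  (forall n r, 0 <= v n r <= C) ->
  exists ph : nat -> nat, (forall k, (k <= ph k)%N) /\
    forall r, 0 < r -> cvg (v (ph k) r @[k --> \oo]).
Proof.
move=> sv vC.
have C0 : 0 <= C by have /andP[a b] := vC 0%N 0; exact: le_trans a b.
pose f n : {ptws rat -> R} := fun q => v n (ratr q).
pose K := [set g : {ptws rat -> R} | forall q, `[0, C]%classic (g q)].
have cK : compact K.
  have := @tychonoff rat (fun=> R) (fun=> `[0, C]%classic); apply=> q.
  exact: segment_compact.
have /cK[] : (f @ \oo) K.
  by exists 0%N => //= n _ q; rewrite /K/= in_itv/=; exact: vC.
move=> c [Kc clc].
have H k : exists n, (k <= n)%N /\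
    forall j : 'I_k.+1, if unpickle j is Some q then `|c q - v n (ratr q)| < k.+1%:R^-1 else true.
  have := clc [set g | exists2 n, (k <= n)%N & g = f n]
    [set g | forall j : 'I_k.+1, if unpickle j is Some q then `|c q - g q| < k.+1%:R^-1 else true].
  case.
  - by exists k => //= n kn; exists n.
  - apply: (@filter_forall _ _ (fun (j : 'I_k.+1) (g : {ptws rat -> R}) =>
      is_true (if unpickle j is Some q then `|c q - g q| < k.+1%:R^-1 else true))
      (nbhs c) _) => j; case: unpickle => [q|]; last exact: nearW.
    have nb : nbhs (c q : R) [set y : R | `|c q - y| < k.+1%:R^-1].
      by apply: (@nbhsx_ballx R R); rewrite invr_gt0.
    exact: (@proj_continuous rat (fun=> R) q c _ nb).
  - by move=> g [[n kn ->] hg]; exists n.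
have [ph hph] := choice H.
exists ph; split; first by move=> k; have [] := hph k.
move=> r r0; apply/cauchy_cvgP; apply: cauchy_exP => e e0.
have [q [q0 qr hq]] := @shaped_near r C (e / 3) r0 C0 (divr_gt0 e0 (ltr0n _ 3)).
(* The Cauchy criterion is met with a ball centred at [c q]: the values at [q] tend to [c q], and
   those at [r] stay within [e / 3] of them. *)
exists (c q).
have [N _ hN] := @near_infty_natSinv_lt R (PosNum (divr_gt0 e0 (ltr0n R 3))).
exists (maxn N (pickle q)) => //= k /=; rewrite geq_max => /andP[Nk qk].
have [_ hk] := hph k.
have := hk (Ordinal (leq_ltn_trans qk (ltnSn k))).
rewrite [nat_of_ord _]/(pickle q) pickleK => h1; have := hN k Nk => /= h2.
have := hq _ (sv (ph k)) (vC _ _); rewrite /ball/=.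
move: h1 h2; set x := v _ _; set y := v _ _ => h1 h2 h3.
have -> : c q - y = (c q - x) + (x - y) by ring.
apply: (le_lt_trans (ler_normD _ _)).
by apply: (lt_le_trans (ltr_leD (lt_trans h1 h2) h3)); lra.
Qed.
End extraction.

(** * Passage to the limit and the fixed point *)

Section limit.
Variable R : realType.
Local Notation mu := (@lebesgue_measure R).
Implicit Types (r s t C : R) (w z b f g : R -> R).

Lemma src_cvg (u : nat -> R -> R) w r : u n r @[n --> \oo] --> w r ->
  src (u n) r @[n --> \oo] --> src w r.
Proof.
move=> uw; apply: cvgM; last exact: cvg_cst.
exact: (cvgM uw (cvgM uw uw)).
Qed.

Lemma cvg_Rintegral_dominated (f_ : nat -> R -> R) f g :
  (forall n, measurable_fun setT (f_ n)) -> measurable_fun setT f ->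
  (forall r, f_ n r @[n --> \oo] --> f r) ->
  mu.-integrable setT (EFin \o g) -> (forall n r, 0 <= f_ n r <= g r) ->
  (\int[mu]_r f_ n r) @[n --> \oo] --> \int[mu]_r f r.
Proof.
move=> mf_ mf ff ig fg.
have c1 : {ae mu, forall r, setT r -> (f_ n r)%:E @[n --> \oo] --> (f r)%:E}.
  by apply: aeW => r _; apply: cvg_EFin; [exact: nearW|exact: ff].
have c2 : {ae mu, forall r n, setT r -> (`|(f_ n r)%:E| <= (EFin \o g) r)%E}.
  by apply: aeW => r n _; have /andP[h1 h2] := fg n r; rewrite gee0_abs lee_fin.
have m1 n : measurable_fun setT (fun r => (f_ n r)%:E) by exact/measurable_EFinP.
have m2 : measurable_fun setT (fun r => (f r)%:E) by exact/measurable_EFinP.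
have [fi _ H] := @dominated_convergence _ _ _ mu setT measurableT _ _ _ m1 m2 c1 ig c2.
apply: fine_cvg; rewrite fineK; first exact: H.
exact: (integrable_fin_num measurableT fi).
Qed.

Lemma Jf_cvg C C' (u z : nat -> R -> R) w y :
  (forall n, cls C (u n)) -> (forall n, cls C' (z n)) -> cls C w -> cls C' y ->
  (forall r, u n r @[n --> \oo] --> w r) -> (forall r, z n r @[n --> \oo] --> y r) ->
  Jf (u n) (z n) @[n --> \oo] --> Jf w y.
Proof.
move=> cu cz cw cy uw zy.
apply: (@cvg_Rintegral_dominated _ _ (fun r => (C ^+ 3 * C') * kap r)).
- by move=> n; exact: measurable_srcM (cu n) (cz n).
- exact: measurable_srcM cw cy.
- by move=> r; apply: cvgM; [exact: src_cvg|exact: zy].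
- by apply: integrableZ; exact: integrable_kap.
- by move=> n r; exact: src_mul_le.
Qed.

Lemma top_cvg C (u : nat -> R -> R) w r :
  (forall n, cls C (u n)) -> cls C w ->
  (forall r, u n r @[n --> \oo] --> w r) -> top (u n) r @[n --> \oo] --> top w r.
Proof.
move=> cu cw uw.
apply: (@cvg_Rintegral_dominated _ _ (fun s => (C ^+ 3 * sg r) * kap s)).
- move=> n; exact: (measurableT_comp (measurable_green_src (cu n)) (@pair1_measurable _ _ _ _ r)).
- exact: (measurableT_comp (measurable_green_src cw) (@pair1_measurable _ _ _ _ r)).
- by move=> s; apply: cvgM; [exact: cvg_cst|exact: src_cvg].
- by apply: integrableZ; exact: integrable_kap.
- by move=> n s; exact: green_src_le.
Qed.

(** With these normalisations the integrated Young defect is [3 + 1 - 4 = 0], so [w = b] almost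
    everywhere on [r > 0]. The integral operator [top] turns this into an equality at every
    point. *)
Lemma top_eq_of_young_eq C C' w b r : cls C w -> cls C' b -> Jf w w = 1 -> Jf b b = 1 ->
  Jf w b = 1 -> top w r = top b r.
Proof.
move=> cw cb w1 b1 wb1.
have iwb := integrable_srcM cw cb; have iww := integrable_srcM cw cw.
have ibb := integrable_srcM cb cb.
pose g r := 3 * (src w r * w r) + src b r * b r - 4 * (src w r * b r).
have iD : mu.-integrable setT (EFin \o (fun r => 3 * (src w r * w r) + src b r * b r)).
  exact: (integrableD measurableT (integrableZ 3 iww) ibb).
have ig : mu.-integrable setT (EFin \o g).
  exact: (integrableB measurableT iD (integrableZ 4 iwb)).
have gE x : g x = (w x - b x) ^+ 2 * (2 * w x ^+ 2 + (w x + b x) ^+ 2) / x ^+ 2.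
  by rewrite /g /src; ring.
have g0 x : 0 <= g x.
  by rewrite gE divr_ge0 ?sqr_ge0// mulr_ge0 ?sqr_ge0// addr_ge0 ?sqr_ge0// mulr_ge0 ?sqr_ge0.
have Ig : \int[mu]_x g x = 0.
  rewrite /g (RintegralB measurableT iD (integrableZ 4 iwb)).
  rewrite (RintegralD measurableT (integrableZ 3 iww) ibb).
  rewrite (RintegralZl 3 measurableT iww) (RintegralZl 4 measurableT iwb).
  by rewrite -/(Jf w w) -/(Jf b b) -/(Jf w b) w1 b1 wb1; lra.
have IgE : (\int[mu]_x `|(g x)%:E| = 0)%E.
  under eq_integral do rewrite gee0_abs ?lee_fin//.
  by rewrite -[LHS]fineK ?(integrable_fin_num measurableT ig)// -/(Rintegral _ _ _) Ig.
have mg : measurable_fun setT (fun x => (g x)%:E) by apply: measurable_int ig.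
have ae0 := (ae_eq_integral_abs mu measurableT mg).1 IgE.
rewrite /top /Rintegral; congr fine; apply: ge0_ae_eq_integral => //.
- by have /integrableP[] := integrable_green_src r cw.
- by have /integrableP[] := integrable_green_src r cb.
- by move=> s _; rewrite lee_fin; have /andP[] := green_src_le r s cw.
- by move=> s _; rewrite lee_fin; have /andP[] := green_src_le r s cb.
apply: filterS ae0 => s /(_ I) /= [] gs _; congr (_%:E).
have [s0|s0] := leP s 0; first by rewrite greenC green_le0// !mul0r.
move/eqP: gs; rewrite gE mulf_eq0 invr_eq0 expf_eq0/= (gt_eqF s0) orbF mulf_eq0 => /orP[|].
  by rewrite expf_eq0/= subr_eq0 => /eqP wb; rewrite /src wb.
have w20 : 0 <= 2 * w s ^+ 2 by rewrite mulr_ge0// sqr_ge0.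
rewrite paddr_eq0 ?w20 ?sqr_ge0// => /andP[].
rewrite mulf_eq0 pnatr_eq0/= !expf_eq0/= => /eqP ws; rewrite ws add0r => /eqP bs.
by rewrite /src ws bs.
Qed.

Lemma cvg_interlaced (E x : nat -> R) (L : R) : E n @[n --> \oo] --> L ->
  (forall n, E n <= x n) -> (forall n, x n <= E n.+1) -> x n @[n --> \oo] --> L.
Proof.
move=> EL Ex xE; apply: (@squeeze_cvgr _ _ _ _ E (fun n => E n.+1)) => //.
  by apply: nearW => n; rewrite Ex xE.
by rewrite cvg_shiftS.
Qed.

Lemma cvg_subseqS (x : nat -> R) (ph : nat -> nat) (L : R) : x n @[n --> \oo] --> L ->
  (forall k, (k <= ph k)%N) -> x (ph k).+1 @[k --> \oo] --> L.
Proof.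
move=> xL phk.
have phoo : ph k @[k --> \oo] --> \oo.
  by move=> A [N _ NA]; exists N => // k /= Nk; apply: NA => /=; exact: leq_trans (phk k).
apply: (@cvg_comp _ _ _ ph (fun n => x n.+1) _ _ _ phoo).
by rewrite (cvg_shiftS x).
Qed.

Lemma le_of_mean (x y z : R) : x <= y -> 2 * y <= x + z -> y <= z.
Proof. lra. Qed.

(** Energies and norms have the same limit [L] by interlacing, so the limit function [w] satisfies
    [En w = nu w = L]: equality holds in Young's inequality for [w] and [step w]. *)
Theorem ground_state_fixpoint : exists (m C : R) (w : R -> R),
  [/\ 0 < m, cls C w, forall r, 0 < r -> 0 < w r & forall r, top w r = m * w r].
Proof.
have [w0 nw0] := exists_norm1 R.
pose W n := iter n (@step R) w0.
have nW n : norm1 (W n) by elim: n => // n ih; exact: norm1_step.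
pose E n := En (W n).
have Enu n : E n <= nu (W n) by exact: En_le_nu.
have nuE n : 2 * nu (W n) <= E n + E n.+1 by exact: nu_le.
have nuE' n : nu (W n) <= E n.+1 := le_of_mean (Enu n) (nuE n).
have Einc : nondecreasing_seq E.
  by apply/nondecreasing_seqP => n; exact: le_trans (Enu n) (nuE' n).
have nub n : nu (W n) <= 1 + K0 R.
  by have := nu_sqr_le (nW n); have := nu_gt0 (nW n); nra.
have Eb : has_ubound (range E).
  by exists (1 + K0 R) => _ [n _ <-]; apply: (le_trans (Enu n)).
have Ecv := nondecreasing_is_cvgn Einc Eb.
pose L := limn E.
have EL : E @ \oo --> L by [].
have nuL := cvg_interlaced (x := fun n => nu (W n)) EL Enu nuE'.
have E0 : 0 < E 0 by exact: En_gt0.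
pose C := (Num.sqrt (E 0))^-1.
(* Bounds and shape come from the operator, so they start after one step. *)
have clsW n : cls C (W n.+1) := cls_step (nW n) E0 (Einc 0%N n (leq0n n)).
have C0 : 0 <= C by exact: cls_C0 (clsW 0%N).
have shW n : shaped (W n.+1).
  split=> [r r' rr'|r r' r0 rr']; first exact: (step_expR (nW n) rr').
  exact: (step_sh (nW n) r0 rr').
have bW n r : 0 <= W n.+1 r <= C.
  rewrite (cls_ge0 _ (clsW n))/= (le_trans (cls_le _ (clsW n)))//.
  by rewrite ler_piMr// sg_le1.
have [ph [phk phc]] := shaped_cvg_subsequence shW bW.
pose u k := W (ph k).+1.
have cu k : cls C (u k) by exact: clsW.
have ucv r : cvg (u k r @[k --> \oo]).
  have [r0|r0] := leP r 0; last exact: phc.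
  have -> : (fun k => u k r) = cst 0.
    apply/funext => k; apply/eqP; rewrite eq_le (cls_ge0 _ (cu k)) andbT.
    by rewrite (le_trans (cls_le _ (cu k)))// sg_le0// mulr0.
  exact: is_cvg_cst.
pose w r := limn (fun k => u k r).
have uw r : u k r @[k --> \oo] --> w r by exact: ucv.
have cw : cls C w.
  split.
    by apply: (@measurable_fun_cvg _ _ _ _ u) => // n; case: (cu n).
  move=> r; apply/andP; split.
    by apply: limr_ge; [exact: ucv|apply: nearW => k; exact: cls_ge0 (cu k)].
  by apply: limr_le; [exact: ucv|apply: nearW => k; exact: cls_le (cu k)].
have zc r : top (u k) r @[k --> \oo] --> top w r by exact: top_cvg cu cw uw.
have cz k := cls_top (cu k).
have cz' := cls_top cw.
have w1 : Jf w w = 1.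
  apply: (cvg_unique (@Rhausdorff R) (Jf_cvg cu cu cw cw uw uw)).
  have -> : (fun n => Jf (u n) (u n)) = cst 1 by apply/funext => n; case: (nW (ph n).+1).
  exact: cvg_cst.
have nw : norm1 w by split=> //; exists C.
have wL : En w = L.
  apply: (cvg_unique (@Rhausdorff R) (Jf_cvg cu cz cw cz' uw zc)).
  exact: (cvg_subseqS EL phk).
have zL : Jf (top w) (top w) = L ^+ 4.
  apply: (cvg_unique (@Rhausdorff R) (Jf_cvg cz cz cz' cz' zc zc)).
  have -> : (fun n => Jf (top (u n)) (top (u n))) = (fun n => nu (W (ph n).+1) ^+ 4).
    by apply/funext => n; rewrite nu4.
  have a := cvg_subseqS nuL phk.
  exact: (cvgM a (cvgM a (cvgM a a))).
have L0 : 0 < L by rewrite -wL; exact: En_gt0.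
have nuw : nu w = L.
  have : nu w ^+ 4 = L ^+ 4 by rewrite nu4.
  by move/eqP; rewrite eqrXn2// ?(ltW L0)// ?(ltW (nu_gt0 nw))// => /eqP.
have [[C' cb] b1] := norm1_step nw.
have wb : Jf w (step w) = 1.
  by rewrite /step (Jf_scaler _ cw cz') -/(En w) wL nuw mulVf// gt_eqF.
(* The witness is [step w], since [w] is identified with it only almost everywhere;
   [top (step w) = top w = L * step w] holds at every point. *)
exists L, C', (step w); split=> //.
- move=> r r0; rewrite /step mulr_gt0 ?invr_gt0 ?nuw//.
  by apply: (top_gt0 cw) => //; rewrite w1.
- move=> r; rewrite -(top_eq_of_young_eq r cw cb w1 b1 wb) /step nuw.
  by rewrite mulrA mulfV ?mul1r// gt_eqF.
Qed.
End limit.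

(** * Regularity and bounds for the fixed point *)

Section regularity.
Variable R : realType.
Local Notation mu := (@lebesgue_measure R).
Implicit Types (r s t C : R) (w f g : R -> R).

(* With [z := top w] and [p := pfun w], the second order equation splits into
   [z' = p - z] and [p' = p - src w]. *)
Definition pfun w t : R := \int[mu]_s (ak t s * src w s).

Lemma ak_le0 t s : t <= 0 -> ak t s = 0.
Proof. by move=> t0; rewrite /ak ltNge t0. Qed.

Lemma ak_le1 t s : ak t s <= 1.
Proof.
rewrite /ak; case: ifP => [/andP[_ ts]|_]; last exact: ler01.
by rewrite -[leRHS]expR0 ler_expR; lra.
Qed.

Lemma sg_mono r s : r <= s -> sg r <= sg s.
Proof.
by move=> rs; rewrite ler_wsqrtr// le_min !ge_min rs lexx orbT.
Qed.

(** On the support [s > t] one has [sg t <= sg s], so the bound on [src w s * sg s] can be divided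
    by [sg t]. The majorant degenerates as [t] tends to 0; boundedness of [pfun] there is a separate
    matter. *)
Lemma ak_src_le C w t s : cls C w -> 0 < t ->
  0 <= ak t s * src w s <= (C ^+ 3 / sg t) * kap s.
Proof.
move=> cw t0; have C0 := cls_C0 cw; have st := sg_gt0 t0.
rewrite mulr_ge0 ?ak_ge0 ?(src_ge0 _ cw)//=.
rewrite mulrAC ler_pdivlMr//; apply: le_trans (src_sg_le s cw).
have [ts|st'] := ltP t s; last first.
  rewrite /ak (ltNge t s) st' andbF !mul0r.
  by rewrite mulr_ge0 ?sg_ge0 ?(src_ge0 _ cw).
apply: ler_pM => //; first by rewrite mulr_ge0 ?ak_ge0 ?(src_ge0 _ cw).
- exact: ltW.
- by rewrite ler_piMl ?(src_ge0 _ cw)// ak_le1.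
- exact/sg_mono/ltW.
Qed.

Lemma integrable_ak_src C w t : cls C w ->
  mu.-integrable setT (EFin \o (fun s => ak t s * src w s)).
Proof.
move=> cw; have [t0|t0] := leP t 0.
  apply: (eq_integrable measurableT (cst 0%E)); last exact: integrable0.
  by move=> s _ /=; rewrite ak_le0// mul0r.
apply: (@integrable_dominated _ _ _ mu _ (fun s => (C ^+ 3 / sg t) * kap s)).
- by apply: measurable_funM; [exact: measurable_ak1|exact: measurable_src cw].
- by move=> s; have /andP[h1 h2] := ak_src_le s cw t0; rewrite ger0_norm.
- by apply: integrableZ; exact: integrable_kap.
Qed.

Lemma pfun_ge0 C w t : cls C w -> 0 <= pfun w t.
Proof.
by move=> cw; apply: Rintegral_ge0 => s _; rewrite mulr_ge0 ?ak_ge0 ?(src_ge0 _ cw).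
Qed.

Lemma pfun_le0 w t : t <= 0 -> pfun w t = 0.
Proof.
move=> t0; rewrite /pfun /Rintegral integral0_eq// => s _.
by rewrite ak_le0// mul0r.
Qed.

Lemma EFin_pfun C w t : cls C w -> ((pfun w t)%:E = Pk (src w) t)%E.
Proof.
by move=> cw; rewrite fineK//; apply: integrable_fin_num => //; exact: integrable_ak_src cw.
Qed.

Lemma measurable_pfun C w : cls C w -> measurable_fun setT (pfun w).
Proof.
move=> cw; apply/measurable_EFinP.
have -> : EFin \o pfun w = Pk (src w) by apply/funext => t /=; rewrite (EFin_pfun _ cw).
by apply: measurable_Pk; [exact: measurable_src cw|move=> s; exact: src_ge0 cw].
Qed.

Lemma top_pfun C w r : cls C w ->
  ((top w r)%:E = \int[mu]_t (ak t r * pfun w t)%:E)%E.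
Proof.
move=> cw; rewrite (EFin_top _ cw) green_Pk//.
- by apply: eq_integral => t _; rewrite EFinM (EFin_pfun _ cw).
- exact: measurable_src cw.
- by move=> s; exact: src_ge0 cw.
Qed.

(** Solution of [z' + z = p] by the integrating factor [expR]; starting at minus infinity encodes
    [z(0) = 0], since [pfun] vanishes for [t <= 0]. *)
Lemma top_pfun_itv C w r : cls C w ->
  ((expR r * top w r)%:E = \int[mu]_(t in `]-oo, r]) (expR t * pfun w t)%:E)%E.
Proof.
move=> cw; have mp := measurable_pfun cw.
have mH : measurable_fun setT (fun t => (expR t * pfun w t)%:E).
  by apply/measurable_EFinP; meas.
rewrite -integral_itv_bndo_bndc; last exact: measurable_funTS.
rewrite EFinM (top_pfun _ cw) -ge0_integralZl//.
- rewrite [RHS]integral_mkcond; apply: eq_integral => t _.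
  rewrite patchE -EFinM mulrA; case: ifPn; rewrite ?inE ?notin_setE/= in_itv/=.
    move=> tr; have [t0|t0] := leP t 0; first by rewrite pfun_le0// !mulr0.
    by rewrite /ak t0 tr/= -expRD; congr (_ * _)%:E; congr expR; ring.
  by move=> /negP; rewrite /ak => /negbTE ->; rewrite andbF mulr0 mul0r.
- by apply/measurable_EFinP; apply: measurable_funM => //; exact: measurable_ak2.
- by move=> t _; rewrite lee_fin mulr_ge0 ?ak_ge0// (pfun_ge0 _ cw).
Qed.

Lemma integrable_expR_pfun C w r : cls C w ->
  mu.-integrable `]-oo, r] (EFin \o (fun t => expR t * pfun w t)).
Proof.
move=> cw; have mp := measurable_pfun cw.
apply/integrableP; split.
  by apply/measurable_EFinP; apply: measurable_funTS; meas.
under eq_integral do rewrite gee0_abs ?lee_fin ?mulr_ge0 ?expR_ge0 ?(pfun_ge0 _ cw)//.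
by rewrite -(top_pfun_itv _ cw) ltry.
Qed.

Lemma top_integral_pfun C w r : cls C w ->
  top w r = expR (- r) * \int[mu]_(t in `]-oo, r]) (expR t * pfun w t).
Proof.
move=> cw; rewrite /Rintegral -(top_pfun_itv _ cw)/= mulrA -expRD addNr expR0.
by rewrite mul1r.
Qed.

Lemma continuous_near_eq (f g : R -> R) (x : R) : {near x, f =1 g} ->
  {for x, continuous f} -> {for x, continuous g}.
Proof.
move=> fg cf; rewrite /prop_for /continuous_at -(nbhs_singleton fg).
apply: cvg_trans cf; apply: near_eq_cvg.
by apply: filterS fg => y ->.
Qed.

Lemma near_gt (a x : R) (P : R -> Prop) : a < x -> (forall y, a < y -> P y) ->
  \forall y \near x, P y.
Proof.
move=> ax aP; exists (x - a); first by rewrite /= subr_gt0.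
by move=> y /= xy; apply: aP; have := ler_norm (x - y); lra.
Qed.

Lemma top_itv0 C w x : cls C w -> 0 < x ->
  expR (- x) * \int[mu]_(t in `[0, x]) (expR t * pfun w t) = top w x.
Proof.
move=> cw x0; rewrite (top_integral_pfun _ cw); congr (_ * _).
rewrite Rintegral_mkcond [RHS]Rintegral_mkcond.
apply: eq_Rintegral => t _.
rewrite !patchE; case: ifPn; case: ifPn => //; rewrite ?inE ?notin_setE/= !in_itv/=.
  by move=> h /andP[_ /h].
move=> tx /negP; rewrite negb_and tx orbF -ltNge => t0.
by rewrite pfun_le0 ?mulr0// ltW.
Qed.

Lemma integrable_itv0 C w r : cls C w ->
  mu.-integrable `[0, r] (EFin \o (fun t => expR t * pfun w t)).
Proof.
move=> cw; apply: integrableS (integrable_expR_pfun r cw) => //.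
by move=> x /=; rewrite !in_itv/= => /andP[].
Qed.

(** Start of the bootstrap, from integrability alone. At the fixed point it makes [src w]
    continuous, hence [pfun] differentiable, hence [top w] differentiable. *)
Lemma continuous_top C w r : cls C w -> 0 < r -> {for r, continuous (top w)}.
Proof.
move=> cw r0; have iH := integrable_itv0 (r + 1) cw.
have lt01 : 0 < r + 1 by lra.
have rin : r \in `]0, (r + 1)[ by rewrite in_itv/= r0; lra.
have cF := within_continuous_continuous lt01
  (parameterized_integral_continuous (ltW lt01) iH) rin.
have E x (x0 : 0 < x) := top_itv0 cw x0.
apply: (continuous_near_eq (near_gt r0 E)).
by apply: cvgM; [exact: (der_continuous (der_exp (der_opp (der_id r))))|exact: cF].
Qed.

Lemma is_derive_integral (a : R) (f : R -> R) (x u : R) : x < u ->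
  mu.-integrable `[a, u] (EFin \o f) -> a < x -> {for x, continuous f} ->
  is_derive x 1 (fun y : R => \int[mu]_(t in `[a, y]) f t) (f x).
Proof.
move=> xu fi ax cf; have [d1 d2] := continuous_FTC1_closed xu fi ax cf.
by have := derivableP d1; rewrite -derive1E d2.
Qed.

Lemma integrable_expRN_src C w a : cls C w -> 0 < a ->
  mu.-integrable `]a, +oo[ (EFin \o (fun s => expR (- s) * src w s)).
Proof.
move=> cw a0.
have h := integrableZ (expR (- a)) (integrable_ak_src a cw).
have {}h : mu.-integrable `]a, +oo[
    (EFin \o (fun x => expR (- a) * (ak a x * src w x))).
  by apply: integrableS h.
apply: eq_integrable h => // s; rewrite inE/= in_itv/= andbT => sa.
by rewrite /ak a0 sa/= mulrA -expRD; congr (_ * _)%:E; congr expR; ring.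
Qed.

Lemma pfun_itv C w t : cls C w -> 0 < t ->
  pfun w t = expR t * \int[mu]_(s in `]t, +oo[) (expR (- s) * src w s).
Proof.
move=> cw t0; rewrite -RintegralZl//; last exact: integrable_expRN_src cw t0.
rewrite [RHS]Rintegral_mkcond; apply: eq_Rintegral => s _.
rewrite patchE; case: ifPn; rewrite ?inE ?notin_setE/= in_itv/= andbT.
  by move=> ts; rewrite /ak t0 ts/= mulrA -expRD.
by move=> /negP/negbTE ts; rewrite /ak ts andbF mul0r.
Qed.

Lemma is_derive_pfun C w r : cls C w -> 0 < r -> {for r, continuous (src w)} ->
  is_derive r 1 (pfun w) (pfun w r - src w r).
Proof.
(* A base point [a] strictly between 0 and [r] turns the tail integral from [x] into a constant
   minus an integral over [[a, x]], to which the fundamental theorem applies. *)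
move=> cw r0 cs; pose a := r / 2.
have a0 : 0 < a by rewrite /a; lra.
have ar : a < r by rewrite /a; lra.
pose g s := expR (- s) * src w s.
have ig : mu.-integrable `]a, +oo[ (EFin \o g) := integrable_expRN_src cw a0.
have ig' x : mu.-integrable `]a, x] (EFin \o g).
  by apply: integrableS ig => // y /=; rewrite !in_itv/= => /andP[->].
have igc x : mu.-integrable `[a, x] (EFin \o g).
  have a20 : 0 < a / 2 by lra.
  apply: integrableS (integrable_expRN_src cw a20) => // y /=.
  by rewrite !in_itv/= andbT => /andP[ay _]; lra.
have E x : a < x -> expR x * (\int[mu]_(s in `]a, +oo[) g s -
    \int[mu]_(s in `[a, x]) g s) = pfun w x.
  move=> ax; rewrite (pfun_itv cw (lt_trans a0 ax)) -Rintegral_itv_obnd_cbnd//.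
  by rewrite (Rintegral_itvB ig)// bnd_simp ltW.
have dF : is_derive r 1 (fun y : R => \int[mu]_(t in `[a, y]) g t) (g r).
  apply: (@is_derive_integral a g r (r + 1)) => //; first by lra.
  by apply: cvgM; [exact: (der_continuous (der_exp (der_opp (der_id r))))|exact: cs].
apply: (near_eq_is_derive (near_gt ar E)).
apply: (is_derive_eq (der_mul (der_exp (der_id r)) (der_sub (der_cst r _) dF))).
by rewrite -(E r ar) /g mul1r sub0r mulrN mulrA -expRD subrr expR0 mul1r.
Qed.

Lemma is_derive_top C w r : cls C w -> 0 < r -> {for r, continuous (pfun w)} ->
  is_derive r 1 (top w) (pfun w r - top w r).
Proof.
move=> cw r0 cp.
pose H t := expR t * pfun w t.
have dF : is_derive r 1 (fun y : R => \int[mu]_(t in `[0, y]) H t) (H r).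
  apply: (@is_derive_integral 0 H r (r + 1)) => //; first by lra.
    exact: integrable_itv0 cw.
  by apply: cvgM; [exact: (der_continuous (der_exp (der_id r)))|exact: cp].
have E x (x0 : 0 < x) := top_itv0 cw x0.
apply: (near_eq_is_derive (near_gt r0 E)).
apply: (is_derive_eq (der_mul (der_exp (der_opp (der_id r))) dF)).
rewrite -(E r r0) /H mulrA -expRD addNr expR0 mul1r; ring.
Qed.

Lemma integral_ak t : 0 < t -> (\int[mu]_s (ak t s)%:E = 1)%E.
Proof.
move=> t0.
have cf : continuous (fun s => expR (t - s)).
  by move=> x; exact: (der_continuous (der_exp (der_sub (der_cst x t) (der_id x)))).
have dF (x : R) : is_derive x 1 (fun s => - expR (t - s)) (expR (t - x)).
  by apply: (is_derive_eq (der_opp (der_exp (der_sub (der_cst x t) (der_id x))))); ring.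
transitivity (\int[mu]_(s in `]t, +oo[) (expR (t - s))%:E)%E.
  rewrite [RHS]integral_mkcond; apply: eq_integral => s _.
  rewrite patchE; case: ifPn; rewrite ?inE ?notin_setE/= in_itv/= andbT /ak t0/=.
    by move=> ->.
  by move=> /negP/negbTE ->.
rewrite integral_itv_obnd_cbnd; last first.
  by apply/measurable_EFinP/measurable_funTS; exact: continuous_measurable_fun.
rewrite (@ge0_continuous_FTC2y _ _ (fun s => - expR (t - s)) t 0).
- by rewrite subrr expR0 sub0e EFinN oppeK.
- by move=> x _; exact: expR_ge0.
- exact: continuous_subspaceT.
- have -> : (fun x => - expR (t - x)) = (fun x => (- expR t) * expR (- x)).
    by apply/funext => x; rewrite mulNr -expRD.
  rewrite -[X in _ --> X](mulr0 (- expR t)).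
  by apply: cvgM; [exact: cvg_cst|exact: cvgr_expR].
- by move=> x _; exact: der_derivable (dF x).
- by apply: cvg_at_right_filter; exact: (der_continuous (dF t)).
- by move=> x _; exact: der_derive1 (dF x).
Qed.

Lemma src_le_sqr C w r : cls C w -> 0 < r -> src w r <= C ^+ 3 / r ^+ 2.
Proof.
move=> cw r0; rewrite /src ler_pM2r ?invr_gt0 ?exprn_gt0//.
have C0 := cls_C0 cw; rewrite lerXn2r ?nnegrE ?(cls_ge0 _ cw)//.
by rewrite (le_trans (cls_le _ cw))// ler_piMr// sg_le1.
Qed.

(** [ak t] is a probability density carried by [s > t], where [src w s <= C ^+ 3 / s ^+ 2 <= C ^+ 3
    / t ^+ 2]. *)
Lemma pfun_le_sqr C w t : cls C w -> 0 < t -> pfun w t <= C ^+ 3 / t ^+ 2.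
Proof.
move=> cw t0; have C0 := cls_C0 cw.
rewrite -lee_fin fineK; last exact: (integrable_fin_num _ (integrable_ak_src t cw)).
rewrite -[leRHS]mule1 -(integral_ak t0) -ge0_integralZl//; last first.
- by rewrite lee_fin divr_ge0// exprn_ge0// ltW.
- by move=> s _; rewrite lee_fin ak_ge0.
- by apply/measurable_EFinP; exact: measurable_ak1.
apply: ge0_le_integral => //.
- by move=> s _; rewrite lee_fin mulr_ge0 ?ak_ge0 ?(src_ge0 _ cw).
- by have /integrableP[] := integrable_ak_src t cw.
- by apply: measurable_funeM; apply/measurable_EFinP; exact: measurable_ak1.
move=> s _; rewrite -EFinM lee_fin mulrC.
have [ts|st] := ltP t s; last by rewrite /ak (ltNge t s) st andbF !mulr0.
rewrite ler_wpM2r ?ak_ge0// (le_trans (src_le_sqr cw (lt_trans t0 ts)))//.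
rewrite ler_wpM2l ?exprn_ge0// lef_pV2 ?posrE ?exprn_gt0// ?(lt_trans t0)//.
by rewrite lerXn2r ?nnegrE ?ltW// (lt_trans t0).
Qed.

Lemma top_le_lin C w B r : cls C w -> (forall t, pfun w t <= B) -> 0 < r ->
  top w r <= B * r.
Proof.
move=> cw pB r0; have B0 : 0 <= B by apply: le_trans (pB 0); exact: pfun_ge0 cw.
have mp := measurable_pfun cw.
rewrite -lee_fin (top_pfun _ cw).
apply: (@le_trans _ _ (\int[mu]_(t in `]0%R, r[) B%:E)%E); last first.
  by rewrite integral_cst//= lebesgue_measure_itv/= lte_fin r0 oppr0 adde0 -EFinM.
rewrite [leRHS]integral_mkcond; apply: ge0_le_integral => //.
- by move=> t _; rewrite lee_fin mulr_ge0 ?ak_ge0// (pfun_ge0 _ cw).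
- by apply/measurable_EFinP; apply: measurable_funM => //; exact: measurable_ak2.
- by apply/(measurable_restrictT _ _).1.
move=> t _; rewrite patchE; case: ifPn; rewrite ?inE ?notin_setE/= in_itv/=.
  move=> _; rewrite lee_fin (le_trans _ (pB t))// ler_piMl ?ak_le1//.
  exact: pfun_ge0 cw.
by move=> /negP/negbTE; rewrite /ak => ->; rewrite mul0r.
Qed.

Lemma derive_ge0_nd (f df : R -> R) (a b : R) : a <= b ->
  (forall x, a <= x <= b -> is_derive x 1 f (df x)) ->
  (forall x, a <= x <= b -> 0 <= df x) -> f a <= f b.
Proof.
move=> ab fd fp.
have cf : {within `[a, b], continuous f}.
  apply: derivable_within_continuous => x; rewrite in_itv/= => xab.
  exact: der_derivable (fd x xab).
have fd' x : x \in `]a, b[ -> is_derive x 1 f (df x).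
  by rewrite in_itv/= => /andP[ax xb]; apply: fd; rewrite !ltW.
have [c] := MVT_segment ab fd' cf.
rewrite in_itv/= => cab fE; rewrite -subr_ge0 fE mulr_ge0 ?fp// subr_ge0//.
Qed.

(** Beyond 1 the inverse square bound suffices. Below 1, [p' >= - src w >= - C ^+ 3 / sqrt x], which
    is integrable at 0: adding the primitive [2 * C ^+ 3 * sqrt x] yields the nondecreasing [h]. *)
Lemma pfun_bounded C w : cls C w -> (forall r, 0 < r -> {for r, continuous (src w)}) ->
  exists B, forall t, pfun w t <= B.
Proof.
move=> cw cs; have C0 := cls_C0 cw; have C30 : 0 <= C ^+ 3 by exact: exprn_ge0.
have p0 t : 0 <= pfun w t := pfun_ge0 t cw.
exists (pfun w 1 + 2 * C ^+ 3) => t.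
have [t0|t0] := leP t 0; first by rewrite pfun_le0// addr_ge0// mulr_ge0.
have [t1|t1] := leP t 1; last first.
  apply: (le_trans (pfun_le_sqr cw t0)).
  have : C ^+ 3 / t ^+ 2 <= C ^+ 3.
    by rewrite ler_pdivrMr ?exprn_gt0// ler_peMr// exprn_ege1// ltW.
  by have := p0 1; lra.
pose h (x : R) := pfun w x + 2 * C ^+ 3 * Num.sqrt x.
have : h t <= h 1.
  apply: (@derive_ge0_nd _ (fun x => pfun w x - src w x + (0 * Num.sqrt x +
      2 * C ^+ 3 * (1 * (2 * Num.sqrt x)^-1)))) => //.
    move=> x /andP[tx x1]; have x0 := lt_le_trans t0 tx.
    exact: (der_add (is_derive_pfun cw x0 (cs x x0))
      (der_mul (der_cst x _) (der_comp (der_id x) (is_derive1_sqrt x0)))).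
  move=> x /andP[tx x1]; have x0 := lt_le_trans t0 tx.
  have sx : sg x = Num.sqrt x by rewrite /sg min_l.
  have s0 : 0 < Num.sqrt x by rewrite sqrtr_gt0.
  have : src w x <= C ^+ 3 / Num.sqrt x.
    rewrite ler_pdivlMr// -sx; apply: (le_trans (src_sg_le x cw)).
    rewrite /kap (_ : 4 = 2 * 2)%N// exprM (sg_sqr (ltW x0)) min_l//.
    by rewrite divff ?mulr1// expf_neq0// gt_eqF.
  have -> : 2 * C ^+ 3 * (1 * (2 * Num.sqrt x)^-1) = C ^+ 3 / Num.sqrt x.
    by field; rewrite gt_eqF.
  by have := p0 x; lra.
rewrite /h sqrtr1 mulr1; have : 0 <= 2 * C ^+ 3 * Num.sqrt t.
  by rewrite !mulr_ge0// sqrtr_ge0.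
by lra.
Qed.

End regularity.

(** * The radial profile: decay at infinity, boundedness at the origin *)

Section profile.
Variable R : realType.
Implicit Types (z p : R -> R) (m B D r : R).

(** Barrier for [z' + z = p <= D / r ^+ 2]. From 4 on, [Q / r ^+ 2] is a supersolution because
    [Q - 2 * Q / r >= Q / 2 >= D]; the summand [16 * z 4] of [Q] places it above [z] at 4. *)
Lemma ode_decay z p B D :
  (forall r, 0 < r -> is_derive r 1 z (p r - z r)) ->
  (forall r, 0 <= p r) -> (forall r, 0 < r -> 0 < z r) ->
  (forall r, 0 < r -> z r <= B * r) -> (forall r, 0 < r -> p r <= D / r ^+ 2) ->
  exists K, forall r, 0 < r -> r ^+ 2 * z r <= K.
Proof.
move=> dz p0 z0 zB pD.
have D0 : 0 <= D by have := le_trans (p0 1) (pD 1 ltr01); rewrite expr1n divr1.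
have B0 : 0 <= B by have := le_trans (ltW (z0 1 ltr01)) (zB 1 ltr01); rewrite mulr1.
have z4 := z0 4 (ltr0n _ 4).
pose Q := 2 * D + 16 * z 4.
have Q0 : 0 <= Q by rewrite /Q; lra.
exists (64 * B + Q) => r r0.
have [r4|r4] := leP r 4.
  have h1 : r ^+ 2 <= 16 by nra.
  have h2 : z r <= B * 4 by apply: (le_trans (zB r r0)); rewrite ler_wpM2l.
  have : r ^+ 2 * z r <= 16 * (B * 4) by rewrite ler_pM ?sqr_ge0// ltW// z0.
  by lra.
pose y (x : R) := expR x * (Q / x ^+ 2 - z x).
have : y 4 <= y r.
  apply: (@derive_ge0_nd _ _ (fun x => 1 * expR x * (Q / x ^+ 2 - z x) + expR x *
    ((0 * x ^+ 2 - Q * (2 * x * 1)) / (x ^+ 2) ^+ 2 - (p x - z x)))); first exact: ltW.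
    move=> x /andP[x4 _]; have x0 : 0 < x by lra.
    have x20 : x ^+ 2 != 0 by rewrite expf_neq0// gt_eqF.
    exact: (der_mul (der_exp (der_id x)) (der_sub (der_div (g := fun t : R => t ^+ 2) x20 (der_cst x Q) (der_sqr (der_id x))) (dz x x0))).
  move=> x /andP[x4 _]; have x0 : 0 < x by lra.
  have -> : 1 * expR x * (Q / x ^+ 2 - z x) + expR x *
    ((0 * x ^+ 2 - Q * (2 * x * 1)) / (x ^+ 2) ^+ 2 - (p x - z x)) =
    expR x * ((Q - 2 * Q / x) / x ^+ 2 - p x) by field; rewrite gt_eqF.
  rewrite mulr_ge0 ?expR_ge0// subr_ge0 (le_trans (pD x x0))//.
  rewrite ler_pM2r ?invr_gt0 ?exprn_gt0//.
  have : 2 * Q / x <= Q / 2 by rewrite ler_pdivrMr//; nra.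
  by rewrite /Q; lra.
have : 0 <= y 4 by rewrite mulr_ge0 ?expR_ge0// subr_ge0 ler_pdivlMr// /Q; lra.
move=> /le_trans h /h; rewrite pmulr_rge0 ?expR_gt0// subr_ge0.
by rewrite ler_pdivlMr ?exprn_gt0// mulrC; lra.
Qed.

Lemma small_at_zero (d dd : R -> R) (K A : R) : 0 <= K -> 0 <= A ->
  (forall r, 0 < r -> is_derive r 1 d (dd r)) ->
  (forall r, 0 < r -> `|dd r| <= K * r ^+ 2) ->
  (forall r, 0 < r -> `|d r| <= A * (r + r ^+ 2)) ->
  forall r, 0 < r -> `|d r| <= K * r ^+ 3.
Proof.
move=> K0 A0 Hd Hdd Hsm r r0; apply/ler_addgt0Pr => e e0.
have k0 : 0 < A * (1 + r) + 1 by rewrite ltr_wpDl// mulr_ge0//; lra.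
(* From [x <= r] follows [A * (x + x ^+ 2) <= A * (1 + r) * x <= e]; the added 1 keeps the
   denominator positive when [A = 0]. *)
pose x := Num.min r (e / (A * (1 + r) + 1)).
have x0 : 0 < x by rewrite lt_min r0 divr_gt0.
have xr : x <= r by rewrite ge_min lexx.
have xe : A * (x + x ^+ 2) <= e.
  have : x <= e / (A * (1 + r) + 1) by rewrite ge_min lexx orbT.
  rewrite ler_pdivlMr// => h.
  have : A * (x * x) <= A * (x * r) by rewrite ler_wpM2l// ler_wpM2l// ltW.
  by rewrite expr2; lra.
have dx := le_trans (Hsm x x0) xe.
have Hb t : x <= t <= r -> `|dd t| <= K * r ^+ 2.
  move=> /andP[xt tr]; have t0 := lt_le_trans x0 xt.
  by apply: (le_trans (Hdd t t0)); rewrite ler_wpM2l// lerXn2r ?nnegrE// ltW.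
have h1 : K * r ^+ 2 * x + d x <= K * r ^+ 2 * r + d r.
  apply: (@derive_ge0_nd _ (fun t => K * r ^+ 2 * t + d t)
    (fun t => 0 * t + K * r ^+ 2 * 1 + dd t) _ _ xr).
    move=> t /andP[xt tr]; have t0 := lt_le_trans x0 xt.
    exact: (der_add (der_mul (der_cst t _) (der_id t)) (Hd t t0)).
  by move=> t /Hb; rewrite ler_norml => /andP[]; lra.
have h2 : K * r ^+ 2 * x - d x <= K * r ^+ 2 * r - d r.
  apply: (@derive_ge0_nd _ (fun t => K * r ^+ 2 * t - d t)
    (fun t => 0 * t + K * r ^+ 2 * 1 - dd t) _ _ xr).
    move=> t /andP[xt tr]; have t0 := lt_le_trans x0 xt.
    exact: (der_sub (der_mul (der_cst t _) (der_id t)) (Hd t t0)).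
  by move=> t /Hb; rewrite ler_norml => /andP[]; lra.
have h3 : 0 <= K * r ^+ 2 * x by rewrite !mulr_ge0// ?sqr_ge0// ltW.
move: dx; rewrite !ler_norml => /andP[d1 d2].
by rewrite exprSr mulrA; apply/andP; split; lra.
Qed.

(* [psi = phi' / r] stays bounded at the origin, which makes the gradient
   [x * psi] of the radial function bounded and differentiable off the axis. *)
Definition is_profile (c K : R) (phi psi : R -> R) :=
  (forall r, 0 < phi r) /\ forall r, 0 < r ->
  [/\ is_derive r 1 phi (r * psi r),
      is_derive r 1 psi ((phi r - c * phi r ^+ 3 - 3 * psi r) / r),
      phi r <= K /\ `|psi r| <= K, r ^+ 3 * phi r <= K & r ^+ 4 * `|psi r| <= K].

(** Here [d = r z' - z], so [phi = z / r] has derivative [d / r ^+ 2], and [psi = d / r ^+ 3]. The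
    first derivatives cancel in [d' = r z''], which is O(r^2) at the origin; hence [d] is O(r^3) and
    [psi] stays bounded. *)
Lemma profile_of_ode z p m B D : 0 < m ->
  (forall r, 0 < r -> is_derive r 1 z (p r - z r)) ->
  (forall r, 0 < r -> is_derive r 1 p (p r - z r ^+ 3 / (m ^+ 3 * r ^+ 2))) ->
  (forall r, 0 < r -> 0 < z r) -> (forall r, 0 <= p r <= B) ->
  (forall r, 0 < r -> z r <= B * r) -> (forall r, 0 < r -> p r <= D / r ^+ 2) ->
  exists c K phi psi, 0 < c /\ is_profile c K phi psi.
Proof.
move=> m0 dz dp z0 pB zB pD.
have p0 r : 0 <= p r by have /andP[] := pB r.
have B0 : 0 <= B by have /andP[/le_trans h /h] := pB 0.
have m30 : 0 < m ^+ 3 by rewrite exprn_gt0.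
have [K1 hK1] := ode_decay dz p0 z0 zB pD.
pose d (r : R) := r * (p r - z r) - z r.
pose dd (r : R) := r * (z r - z r ^+ 3 / (m ^+ 3 * r ^+ 2)).
have Hd r : 0 < r -> is_derive r 1 d (dd r).
  move=> r0; apply: (is_derive_eq (der_sub (der_mul (der_id r) (der_sub (dp r r0) (dz r r0))) (dz r r0))).
  by rewrite /dd; ring.
pose Cd := B + B ^+ 3 / m ^+ 3.
have Cd0 : 0 <= Cd by rewrite addr_ge0// divr_ge0 ?exprn_ge0// ltW.
have Hdd r : 0 < r -> `|dd r| <= Cd * r ^+ 2.
  move=> r0; rewrite /dd mulrBr; apply: (le_trans (ler_normB _ _)).
  rewrite /Cd mulrDl lerD//.
    rewrite (ger0_norm (mulr_ge0 (ltW r0) (ltW (z0 r r0)))).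
    by have := ler_wpM2l (ltW r0) (zB r r0); rewrite expr2; lra.
  have z30 : 0 <= z r ^+ 3 by rewrite exprn_ge0// ltW// z0.
  rewrite ger0_norm; last by rewrite (mulr_ge0 (ltW r0))// divr_ge0// mulr_ge0 ?sqr_ge0// (ltW m30).
  have -> : r * (z r ^+ 3 / (m ^+ 3 * r ^+ 2)) = z r ^+ 3 / (m ^+ 3 * r).
    by field; rewrite !gt_eqF.
  have -> : B ^+ 3 / m ^+ 3 * r ^+ 2 = (B * r) ^+ 3 / (m ^+ 3 * r).
    by field; rewrite !gt_eqF.
  rewrite ler_pM2r ?invr_gt0 ?mulr_gt0// lerXn2r ?nnegrE ?zB ?(ltW (z0 r r0))//.
  by rewrite mulr_ge0// ltW.
have Hsm r : 0 < r -> `|d r| <= (2 * B) * (r + r ^+ 2).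
  move=> r0; have /andP[p1 p2] := pB r; have := zB r r0; have := z0 r r0 => z1 z2.
  have q1 : r * p r <= r * B by rewrite ler_wpM2l// ltW.
  have q2 : r * z r <= r * (B * r) by rewrite ler_wpM2l// ltW.
  have q3 : 0 <= r * p r by rewrite mulr_ge0// ltW.
  have q4 : 0 <= r * z r by rewrite mulr_ge0// ltW.
  have q5 : 0 <= B * r by rewrite mulr_ge0// ltW.
  by rewrite /d ler_norml; apply/andP; split; rewrite expr2; lra.
have B20 : 0 <= 2 * B by rewrite mulr_ge0.
have Hd3 := small_at_zero Cd0 B20 Hd Hdd Hsm.
(* The value 1 off the half-line is arbitrary; it makes [phi] positive at the centre too, as
   positivity at every point requires. *)
pose phi r := if 0 < r then z r / r else 1.
pose psi r := d r / r ^+ 3.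
have phiE r : 0 < r -> phi r = z r / r by rewrite /phi => ->.
have K10 : 0 <= K1 by apply: le_trans (hK1 1 ltr01); rewrite mulr_ge0 ?sqr_ge0// ltW// z0.
have D0 : 0 <= D by have := le_trans (p0 1) (pD 1 ltr01); rewrite expr1n divr1.
exists (m ^- 3), (B + Cd + K1 + D + (B + K1) + K1), phi, psi; split; first by rewrite invr_gt0.
split; first by move=> r; rewrite /phi; case: ifPn => // r0; rewrite divr_gt0// z0.
move=> r r0.
have rn0 : r != 0 by rewrite gt_eqF.
have psir : `|psi r| = `|d r| / r ^+ 3.
  by rewrite /psi normrM normfV (ger0_norm (exprn_ge0 _ (ltW r0))).
split.
- have E x : 0 < x -> z x / x = phi x by move=> x0; rewrite phiE.
  apply: (near_eq_is_derive (near_gt r0 E)).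
  by apply: (is_derive_eq (der_div (g := fun t : R => t) rn0 (dz r r0) (der_id r))); rewrite /psi /d; field.
- have r3n0 : r * (r * r) != 0 by rewrite !mulf_neq0.
  apply: (is_derive_eq (der_div (g := fun t : R => t * (t * t)) r3n0 (Hd r r0) (der_mul (der_id r) (der_mul (der_id r) (der_id r))))).
  by rewrite /dd phiE// /psi; field; rewrite rn0 gt_eqF.
- split; first by rewrite phiE// ler_pdivrMr//; have := zB r r0; nra.
  rewrite psir ler_pdivrMr ?exprn_gt0//.
  have r30 : 0 < r ^+ 3 by rewrite exprn_gt0.
  by have := Hd3 r r0; nra.
- have -> : r ^+ 3 * phi r = r ^+ 2 * z r by rewrite phiE//; field.
  by have := hK1 r r0; lra.
- have -> : r ^+ 4 * `|psi r| = r * `|d r| by rewrite psir; field.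
  have rz : r * z r <= B + K1.
    have [r1|r1] := leP r 1.
      have a : z r <= B by apply: (le_trans (zB r r0)); rewrite ler_piMr.
      have := z0 r r0 => b; apply: (@le_trans _ _ (1 * z r)); last by lra.
      by rewrite ler_wpM2r// ltW.
    have := hK1 r r0; have : r * z r <= r ^+ 2 * z r.
      by rewrite ler_pM2r ?z0// expr2 ler_peMl ?ltW.
    by lra.
  have rp : r ^+ 2 * p r <= D by have := pD r r0; rewrite ler_pdivlMr ?exprn_gt0// mulrC.
  have q1 : 0 <= r ^+ 2 * p r by rewrite mulr_ge0 ?sqr_ge0.
  have q2 : 0 <= r * z r by rewrite mulr_ge0 ?ltW ?z0.
  have q3 : 0 <= r ^+ 2 * z r by rewrite mulr_ge0 ?sqr_ge0 ?ltW ?z0.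
  have q4 := hK1 r r0.
  have -> : r * `|d r| = `|r ^+ 2 * p r - r ^+ 2 * z r - r * z r|.
    rewrite -{1}(ger0_norm (ltW r0)) -normrM; congr `|_|; rewrite /d; ring.
  by rewrite ler_norml; apply/andP; split; lra.
Qed.

Theorem exists_profile : exists c K phi psi, 0 < c /\ is_profile c K phi psi.
Proof.
have [m [C [w [m0 cw w0 wE]]]] := ground_state_fixpoint R.
have srcE r : src w r = top w r ^+ 3 / (m ^+ 3 * r ^+ 2).
  have m3n : m ^+ 3 != 0 by rewrite expf_neq0// gt_eqF.
  by rewrite wE exprMn invfM [RHS]mulrACA (mulfV m3n) mul1r.
have cs r : 0 < r -> {for r, continuous (src w)}.
  move=> r0.
  have -> : src w = fun x => top w x ^+ 3 / (m ^+ 3 * x ^+ 2).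
    by apply/funext => x; exact: srcE.
  have ct := continuous_top cw r0.
  apply: cvgM; first exact: (cvgM ct (cvgM ct ct)).
  have n0 : m ^+ 3 * r ^+ 2 != 0 by rewrite mulf_neq0// expf_neq0// gt_eqF.
  exact: (der_continuous (der_inv (f := fun t : R => m ^+ 3 * t ^+ 2) n0 (der_mul (der_cst r _) (der_sqr (der_id r))))).
have [B pB] := pfun_bounded cw cs.
have dp r : 0 < r -> is_derive r 1 (pfun w) (pfun w r - top w r ^+ 3 / (m ^+ 3 * r ^+ 2)).
  by move=> r0; rewrite -srcE; exact: is_derive_pfun cw r0 (cs r r0).
apply: (@profile_of_ode (top w) (pfun w) m B (C ^+ 3)) => //.
- move=> r r0; apply: (is_derive_top cw r0); exact: der_continuous (dp r r0).
- by move=> r r0; rewrite wE mulr_gt0// w0.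
- by move=> r; rewrite (pfun_ge0 _ cw) pB.
- by move=> r r0; exact: top_le_lin cw pB r0.
- by move=> r r0; exact: pfun_le_sqr cw r0.
Qed.
End profile.

(** * Fubini's theorem and sigma-finiteness for products *)

Section product_measures.
Context d1 d2 (T1 : measurableType d1) (T2 : measurableType d2) (R : realType).
Variable m1 : {sigma_finite_measure set T1 -> \bar R}.
Variable m2 : {sigma_finite_measure set T2 -> \bar R}.

Lemma integral_prod_eq0_ae1 (F : T1 * T2 -> \bar R) :
  (m1 \x m2)%E.-integrable setT F ->
  {ae m1, forall x, (\int[m2]_y F (x, y) = 0)%E} -> (\int[(m1 \x m2)%E]_z F z = 0)%E.
Proof.
move=> iF ae0; rewrite -(integral12_prod_meas1 iF).
rewrite (@ae_eq_integral _ _ _ _ setT (cst 0%E) _ measurableT (measurable_fubini_F iF))//.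
  by rewrite integral0.
by apply: filterS ae0 => x h _; exact: h.
Qed.

Lemma integral_prod_eq0_ae2 (F : T1 * T2 -> \bar R) :
  (m1 \x m2)%E.-integrable setT F ->
  {ae m2, forall y, (\int[m1]_x F (x, y) = 0)%E} -> (\int[(m1 \x m2)%E]_z F z = 0)%E.
Proof.
move=> iF ae0; rewrite -(integral21_prod_meas1 iF).
rewrite (@ae_eq_integral _ _ _ _ setT (cst 0%E) _ measurableT (measurable_fubini_G iF))//.
  by rewrite integral0.
by apply: filterS ae0 => x h _; exact: h.
Qed.

Lemma integrable_prodM (f : T1 -> R) (g : T2 -> R) :
  m1.-integrable setT (EFin \o f) -> m2.-integrable setT (EFin \o g) ->
  (m1 \x m2)%E.-integrable setT (EFin \o (fun z => f z.1 * g z.2)).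
Proof.
move=> /integrableP[mf fi] /integrableP[mg gi].
have mf' : measurable_fun setT f by exact/measurable_EFinP.
have mg' : measurable_fun setT g by exact/measurable_EFinP.
have mfg : measurable_fun setT (EFin \o (fun z : T1 * T2 => f z.1 * g z.2)).
  by apply/measurable_EFinP; apply: measurable_funM; exact: measurableT_comp.
apply/(integrable12ltyP _ _ mfg).
have ma : measurable_fun setT (fun x => `|f x|%:E).
  by apply/measurable_EFinP; exact: measurableT_comp.
have mb : measurable_fun setT (fun x => `|g x|%:E).
  by apply/measurable_EFinP; exact: measurableT_comp.
have -> : (\int[m1]_x \int[m2]_y `|(EFin \o (fun z : T1 * T2 => (f z.1 * g z.2)%R)) (x, y)|
    = \int[m1]_x (`|f x|%:E * \int[m2]_y `|g y|%:E))%E.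
  apply: eq_integral => x _; rewrite -ge0_integralZl//.
  by apply: eq_integral => y _; rewrite /= normrM EFinM.
rewrite ge0_integralZr//; last exact: integral_ge0.
rewrite lte_mul_pinfty//; first exact: integral_ge0.
by rewrite ge0_fin_numE//; exact: integral_ge0.
Qed.
End product_measures.

Section sigma_finite_product.
Context d1 d2 (T1 : measurableType d1) (T2 : measurableType d2) (R : realType).
Variable m1 : {sigma_finite_measure set T1 -> \bar R}.
Variable m2 : {sigma_finite_measure set T2 -> \bar R}.

Lemma sigma_finite_product : sigma_finite setT (m1 \x m2)%E.
Proof.
have [F TF Foo] := sigma_finiteT m1; have [G TG Goo] := sigma_finiteT m2.
exists (fun n => if unpickle n is Some (i, j) then F i `*` G j else set0).
  apply/seteqP; split=> // -[x y] _.
  have [i _ Fx] : (\bigcup_i F i) x by rewrite -TF.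
  have [j _ Gy] : (\bigcup_i G i) y by rewrite -TG.
  by exists (pickle (i, j)) => //; rewrite pickleK.
move=> n; case: unpickle => [[i j]|]; last by rewrite measure0.
have [mF F1] := Foo i; have [mG G1] := Goo j.
split; first exact: measurableX.
by rewrite product_measure1E// lte_mul_pinfty// ge0_fin_numE.
Qed.

(* Built by hand: on a product measure, inference picks the sub-probability
   instance and then fails for factors that are only sigma-finite. *)
Let mix := Measure_isSigmaFinite.Build _ _ _ (m1 \x m2)%E sigma_finite_product.
Definition sigma_finite_prod : {sigma_finite_measure set (T1 * T2)%type -> \bar R} :=
  HB.pack (m1 \x m2)%E mix.
End sigma_finite_product.

(** * Change of variables under dilations *)

Section scaling.
Variable R : realType.

(* Restricted to nonnegative functions so that it is stable under products by
   Tonelli's theorem. *)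
Definition scales d (T : measurableType d) (m : set T -> \bar R) (s : T -> T) (a : R) :=
  measurable_fun setT s /\ forall F : T -> \bar R, measurable_fun setT F ->
    (forall x, 0 <= F x)%E -> (\int[m]_x F (s x) = a%:E * \int[m]_x F x)%E.

Lemma scales_id d (T : measurableType d) (m : {measure set T -> \bar R}) :
  scales m id 1.
Proof. by split=> [//|F mF F0]; rewrite mul1e. Qed.

Lemma scales_prod d1 d2 (T1 : measurableType d1) (T2 : measurableType d2)
    (m1 : {sigma_finite_measure set T1 -> \bar R})
    (m2 : {sigma_finite_measure set T2 -> \bar R}) s1 s2 (a1 a2 : R) :
  0 <= a1 -> 0 <= a2 -> scales m1 s1 a1 -> scales m2 s2 a2 ->
  scales (m1 \x m2)%E (fun z => (s1 z.1, s2 z.2)) (a1 * a2).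
Proof.
move=> a10 a20 [ms1 h1] [ms2 h2].
have ms : measurable_fun setT (fun z : T1 * T2 => (s1 z.1, s2 z.2)).
  by apply: measurable_fun_pair; exact: measurableT_comp.
split=> // F mF F0.
have mFs : measurable_fun setT (F \o (fun z => (s1 z.1, s2 z.2))) by exact: measurableT_comp.
rewrite (fubini_tonelli1 _ mFs)//; last by move=> z; exact: F0.
rewrite (fubini_tonelli1 _ mF)// /fubini_F/=.
pose G x := (\int[m2]_y F (x, y))%E.
have mG : measurable_fun setT G by exact: measurable_fun_fubini_tonelli_F.
have G0 x : (0 <= G x)%E by exact: integral_ge0.
transitivity (\int[m1]_x (a2%:E * G (s1 x)))%E.
  apply: eq_integral => x _.
  by rewrite -(h2 (fun y => F (s1 x, y)))//; exact: measurableT_comp.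
rewrite ge0_integralZl//; last exact: measurableT_comp.
by rewrite h1// muleA EFinM (muleC a1%:E).
Qed.

(** Uniqueness of Lebesgue measure: [k] times its image under [x |-> k * x] gives each half-open
    interval its length. *)
Lemma scales_lebesgue (k : R) : 0 < k ->
  scales (@lebesgue_measure R) (fun x => k * x) k^-1.
Proof.
move=> k0; have kn0 : k != 0 by rewrite gt_eqF.
have ms : measurable_fun setT (fun x : R => k * x) by apply: measurable_funM.
split=> // F mF F0.
pose s : measurableTypeR R -> measurableTypeR R := fun x => k * x.
have mss : measurable_fun setT s by [].
have key A : measurable A ->
    lebesgue_measure A = mscale (NngNum (ltW k0)) (pushforward (@lebesgue_measure R) s) A.
  move=> mA; apply: lebesgue_measure_unique => //= _ [[a b] _ <-].
  rewrite /mscale/= /pushforward.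
  have -> : s @^-1` `]a, b] = `]a / k, b / k]%classic.
    apply/seteqP; split => x /=; rewrite !in_itv/= /s ltr_pdivrMr// ler_pdivlMr//;
      by rewrite mulrC.
  rewrite !lebesgue_measure_itv/= !lte_fin ltr_pM2r ?invr_gt0//.
  case: ifP => _; last by rewrite mule0.
  by rewrite -!EFinB -EFinM -mulrBl mulrCA mulfV// mulr1.
have e : (\int[@lebesgue_measure R]_x F x = k%:E * \int[@lebesgue_measure R]_x F (k * x)%R)%E.
  rewrite (@eq_measure_integral _ _ _ setT _ _ F (fun A mA _ => key mss A mA)).
  rewrite (ge0_integral_mscale _ measurableT)//.
  by rewrite (ge0_integral_pushforward mss)// preimage_setT.
by rewrite e muleA -EFinM mulVf// mul1e.
Qed.

End scaling.

(** * Measurability from continuity in one variable *)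

Section caratheodory.
Context d (T : measurableType d) (R : realType).

(** The second variable is rounded down to a grid of mesh [1 / n.+1]: the rounded function is
    measurable on each of countably many strips, and continuity in [y] gives convergence. Iterated
    over coordinates, it makes continuous functions measurable for the product sigma-algebra. *)
Lemma measurable_caratheodory (f : T * R -> R) :
  (forall y, measurable_fun setT (fun x => f (x, y))) ->
  (forall x, continuous (fun y => f (x, y))) -> measurable_fun setT f.
Proof.
move=> mf cf.
pose q n (y : R) : R := (Num.floor (n.+1%:R * y))%:~R / n.+1%:R.
have qy y : q n y @[n --> \oo] --> y.
  apply/cvgrPdist_lt => e e0.
  have [N _ hN] := @near_infty_natSinv_lt R (PosNum e0).
  exists N => // n Nn; have := hN n Nn => /= ne.
  have n0 : 0 < n.+1%:R :> R by rewrite ltr0n.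
  apply: le_lt_trans ne.
  have /andP[h1 h2] := floor_itv (n.+1%:R * y).
  rewrite intrD in h2.
  have -> : y - q n y = (n.+1%:R * y - (Num.floor (n.+1%:R * y))%:~R) / n.+1%:R.
    by rewrite /q; field; rewrite gt_eqF.
  rewrite normrM normfV (ger0_norm (ltW n0)) ler_piMl ?invr_ge0 ?(ltW n0)//.
  by rewrite ger0_norm; lra.
apply: (@measurable_fun_cvg _ _ _ _ (fun n z => f (z.1, q n z.2))).
- move=> n _ A mA.
  have -> : [set: T * R] `&` (fun z => f (z.1, q n z.2)) @^-1` A =
      \bigcup_(k : int) ([set x | A (f (x, k%:~R / n.+1%:R))] `*` [set y | Num.floor (n.+1%:R * y) = k]).
    apply/seteqP; split=> [[x y] [_ /= h]|[x y] [k _ [/= h1 h2]]].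
      by exists (Num.floor (n.+1%:R * y)).
    by split=> //=; rewrite /q h2.
  apply: countable_bigcupT_measurable => // k; apply: measurableX.
    by have := mf (k%:~R / n.+1%:R) measurableT _ mA; rewrite setTI.
  have -> : [set y : R | Num.floor (n.+1%:R * y) = k] =
      `[k%:~R / n.+1%:R, (k + 1)%:~R / n.+1%:R[%classic.
    have n0 : 0 < n.+1%:R :> R by rewrite ltr0n.
    apply/seteqP; split=> y /=; rewrite in_itv/= ler_pdivrMr// ltr_pdivlMr// mulrC.
      by move=> <-; exact: floor_itv.
    by move=> h; exact: floor_def.
  exact: measurable_itv.
- move=> [x y] _ /=; apply: (@cvg_comp _ _ _ (fun n => q n y) (fun y => f (x, y)) _ _ _ (qy y)).
  exact: cf.
Qed.
End caratheodory.

(** * Integrating a derivative of compact support *)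

Section line.
Variable R : realType.
Local Notation mu := (@lebesgue_measure R).

Lemma integral_derive_compact (h h' : R -> R) (M : R) :
  (forall t : R, is_derive t 1 h (h' t)) -> continuous h' ->
  (forall t, M < `|t| -> h t = 0) -> (\int[mu]_t (h' t)%:E = 0)%E.
Proof.
move=> dh ch hM.
have h'M t : M < `|t| -> h' t = 0.
  move=> Mt; rewrite -(der_derive1 (dh t)).
  have E : \forall x \near t, cst (0 : R) x = h x.
    have : \forall x \near t, M < `|x|.
      by have /cvgr_gt := (@norm_continuous _ R t : `|x| @[x --> t] --> `|t|); apply.
    by apply: filterS => x Mx /=; rewrite hM.
  by rewrite (der_derive1 (near_eq_is_derive E (der_cst t 0))).
(* Positive whatever the sign of [M], and strictly beyond [M], so that [h] vanishes at both
   endpoints. *)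
pose N : R := `|M| + 1.
have N0 : 0 < N by rewrite /N ltr_wpDl.
have MN : M < N by rewrite /N (le_lt_trans (ler_norm M))// ltrDl.
have Nlt : - N < N by lra.
transitivity (\int[mu]_(t in `[(- N)%R, N]) (h' t)%:E)%E.
  rewrite [RHS]integral_mkcond; apply: eq_integral => t _.
  rewrite patchE; case: ifPn => //; rewrite notin_setE/= in_itv/= => /negP.
  rewrite -ler_norml -ltNge => Nt; rewrite h'M//; exact: lt_trans Nt.
have ch0 : continuous h by move=> t; exact: (der_continuous (dh t)).
rewrite (@continuous_FTC2 _ h' h)//.
- rewrite !hM ?subee// ?normrN (gtr0_norm N0)//.
- exact: continuous_subspaceT.
- split; first by move=> x _; exact: der_derivable (dh x).
    by apply: cvg_at_right_filter; exact: ch0.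
  by apply: cvg_at_left_filter; exact: ch0.
- by move=> x _; exact: der_derive1 (dh x).
Qed.
End line.

(** * Integration on R^3 x T and restriction to lines *)

Section four_dim.
Variable R : realType.
Local Notation mu := (@lebesgue_measure R).
Local Notation R' := (measurableTypeR R).
(** [S1] to [M4] are the nested products of [mu4], bundled with sigma-finiteness at each level for
    Fubini's theorem. *)
Definition S1 : {sigma_finite_measure set R' -> \bar R} := @lebesgue_measure R.
Definition S2 : {sigma_finite_measure set (R' * R')%type -> \bar R} := sigma_finite_prod S1 S1.
Definition S3 : {sigma_finite_measure set (R' * R' * R')%type -> \bar R} := sigma_finite_prod S2 S1.
Definition M4 : {sigma_finite_measure set (R' * R' * R' * R')%type -> \bar R} := sigma_finite_prod S3 S1.
Implicit Types (p : pt R) (F G H : pt R -> R) (i : 'I_4).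

Lemma continuous_pair (U V : topologicalType) (f : R -> U) (g : R -> V) (t : R) :
  {for t, continuous f} -> {for t, continuous g} ->
  {for t, continuous (fun s => (f s, g s))}.
Proof. by move=> cf cg; apply: cvg_pair. Qed.

Lemma continuous_upd i p : continuous (upd i p).
Proof.
have c (T : topologicalType) (a : T) (t : R) : {for t, continuous (fun=> a)}.
  exact: cvg_cst.
have d (t : R) : {for t, continuous (fun x : R => x)} by exact: cvg_id.
move=> t; case: i => [[|[|[|[|//]]]] Hi]; rewrite /upd/=.
- exact: (continuous_pair (continuous_pair (continuous_pair (d t) (c _ _ t)) (c _ _ t)) (c _ _ t)).
- exact: (continuous_pair (continuous_pair (continuous_pair (c _ _ t) (d t)) (c _ _ t)) (c _ _ t)).
- exact: (continuous_pair (continuous_pair (c _ _ t) (d t)) (c _ _ t)).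
- exact: (continuous_pair (c _ _ t) (d t)).
Qed.

Lemma continuous_line F i p : continuous F -> continuous (fun t => F (upd i p t)).
Proof.
move=> cF t; apply: (@continuous_comp _ _ _ (upd i p) F); first exact: continuous_upd.
exact: cF.
Qed.

Lemma measurable_continuous_pt F : continuous F -> measurable_fun setT F.
Proof.
move=> cF; apply: measurable_caratheodory => [y|[[x1 x2] x3]]; last first.
  exact: (@continuous_line F (@Ordinal 4 3 isT) (x1, x2, x3, 0) cF).
apply: measurable_caratheodory => [x3|[x1 x2]]; last first.
  exact: (@continuous_line F (@Ordinal 4 2 isT) (x1, x2, 0, y) cF).
apply: measurable_caratheodory => [x2|x1]; last first.
  exact: (@continuous_line F (@Ordinal 4 1 isT) (x1, 0, x3, y) cF).
apply: continuous_measurable_fun.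
exact: (@continuous_line F (@Ordinal 4 0 isT) (0, x2, x3, y) cF).
Qed.

Definition rho p : R := Num.sqrt (p.1.1.1 ^+ 2 + p.1.1.2 ^+ 2 + p.1.2 ^+ 2).

Lemma rho_ge0 p : 0 <= rho p. Proof. exact: sqrtr_ge0. Qed.

Lemma sum_sqr_ge0 p : 0 <= p.1.1.1 ^+ 2 + p.1.1.2 ^+ 2 + p.1.2 ^+ 2.
Proof. by rewrite !addr_ge0 ?sqr_ge0. Qed.

Lemma rho_sqr p : rho p ^+ 2 = p.1.1.1 ^+ 2 + p.1.1.2 ^+ 2 + p.1.2 ^+ 2.
Proof. by rewrite sqr_sqrtr// sum_sqr_ge0. Qed.

Lemma coord_sqr_le i p : (i < 3)%N -> coord i p ^+ 2 <= rho p ^+ 2.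
Proof.
rewrite rho_sqr.
have a := sqr_ge0 p.1.1.1; have b := sqr_ge0 p.1.1.2; have c := sqr_ge0 p.1.2.
by case: i => [[|[|[|[|//]]]] Hi] //= _; rewrite /coord/=; lra.
Qed.

Lemma coord_le_rho i p : (i < 3)%N -> `|coord i p| <= rho p.
Proof.
move=> i3; rewrite -ler_sqr ?nnegrE ?normr_ge0 ?rho_ge0//.
by rewrite real_normK ?num_real// coord_sqr_le.
Qed.

Lemma measurable_x1 : measurable_fun setT (fun p : pt R => p.1.1.1).
Proof. by do 2 apply: (measurableT_comp measurable_fst). Qed.

Lemma measurable_x2 : measurable_fun setT (fun p : pt R => p.1.1.2).
Proof.
by apply: (measurableT_comp measurable_snd); apply: (measurableT_comp measurable_fst).
Qed.

Lemma measurable_x3 : measurable_fun setT (fun p : pt R => p.1.2).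
Proof. exact: (measurableT_comp measurable_snd). Qed.

Lemma measurable_coord i : measurable_fun setT (coord (R := R) i).
Proof.
rewrite /coord; case: i => [[|[|[|[|//]]]] Hi] /=.
- exact: measurable_x1.
- exact: measurable_x2.
- exact: measurable_x3.
- exact: measurable_snd.
Qed.

Lemma measurable_rho : measurable_fun setT rho.
Proof.
have m1 := measurable_x1; have m2 := measurable_x2; have m3 := measurable_x3.
by rewrite /rho; meas.
Qed.

(** The radius is never negative, so off the open half-line [f] may be replaced by the constant
    [f 0]; continuity is assumed for [r > 0] only. *)
Lemma measurable_radial (f : R -> R) : (forall r, 0 < r -> {for r, continuous f}) ->
  measurable_fun setT (fun p => f (rho p)).
Proof.
move=> cf; pose g r := if 0 < r then f r else f 0.
have -> : (fun p => f (rho p)) = g \o rho.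
  apply/funext => p; rewrite /= /g; case: ifPn => //; rewrite -leNgt => h.
  by congr f; apply/eqP; rewrite eq_le h rho_ge0.
apply: measurableT_comp measurable_rho.
apply: measurable_fun_if => //; first exact: measurable_fun_ltr.
have -> : setT `&` (fun t : R => 0 < t) @^-1` [set true] = `]0, +oo[%classic.
  by apply/seteqP; split=> x /=; rewrite in_itv/= andbT; [case|].
apply: open_continuous_measurable_fun => [|x]; first exact: interval_open.
by rewrite inE/= in_itv/= andbT; exact: cf.
Qed.

Definition period_indic (y : R) : R := if (0 <= y) && (y < 2 * pi) then 1 else 0.

(* Integrability over the fundamental domain, written on the whole space so that
   Fubini's theorem applies. *)
Definition I4 F := M4.-integrable setT (EFin \o (fun p => F p * period_indic p.2)).

Lemma period_indic_ge0 y : 0 <= period_indic y.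
Proof. by rewrite /period_indic; case: ifP. Qed.

Lemma measurable_period_indic : measurable_fun setT period_indic.
Proof. by rewrite /period_indic; meas. Qed.

Lemma restrict_dom4 F : F \_ (dom4 (R := R)) = fun p => F p * period_indic p.2.
Proof.
apply/funext => p; rewrite patchE /period_indic; case: ifPn.
  by rewrite inE /dom4/= => ->; rewrite mulr1.
by rewrite notin_setE /dom4/= => /negP/negbTE ->; rewrite mulr0.
Qed.

Lemma integral4E F : integral4 F = \int[M4]_p (F p * period_indic p.2).
Proof. by rewrite /integral4 Rintegral_mkcond restrict_dom4. Qed.

Lemma measurable_dom4 : measurable (dom4 (R := R)).
Proof.
have -> : dom4 (R := R) = setT `*` `[0, (2 * pi)[%classic.
  by apply/seteqP; split=> p; rewrite /dom4/= in_itv/=; [split|case].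
by apply: measurableX => //; exact: measurable_itv.
Qed.

Lemma I4P F : I4 F <-> (mu4 (R := R)).-integrable (dom4 (R := R)) (EFin \o F).
Proof.
have h := @integrable_mkcond _ _ _ M4 (dom4 (R := R)) (EFin \o F) measurable_dom4.
by rewrite restrict_EFin restrict_dom4 in h; split=> /h.
Qed.

Lemma I4_dominated F G : measurable_fun setT F ->
  (forall p, 0 <= p.2 < 2 * pi -> `|F p| <= G p) -> I4 G -> I4 F.
Proof.
move=> mF FG; apply: integrable_dominated.
  apply: measurable_funM => //; apply: (measurableT_comp measurable_period_indic).
  exact: measurable_snd.
move=> p; rewrite /period_indic; case: ifP => h; last by rewrite !mulr0 normr0.
by rewrite !mulr1 FG.
Qed.

Lemma I4Z F (a : R) : I4 F -> I4 (fun p => a * F p).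
Proof.
move=> iF; rewrite /I4 (_ : (fun p => _) = (fun p => a * (F p * period_indic p.2))).
  exact: integrableZ.
by apply/funext => p; rewrite mulrA.
Qed.

Lemma integrable_indicator (P : R -> bool) : measurable [set x | P x] ->
  (mu [set x | P x] < +oo)%E ->
  mu.-integrable setT (EFin \o (fun x => if P x then 1 else 0)).
Proof.
move=> mP muP.
have E : (fun x => if P x then 1 else 0) = \1_[set x | P x] :> (R -> R).
  by apply/funext => x; rewrite indicE; case: ifPn => h; [rewrite mem_set|rewrite memNset//; exact/negP].
rewrite E; apply/integrableP; split; first exact/measurable_EFinP.
under eq_integral do rewrite gee0_abs ?lee_fin//.
by rewrite integral_indic// setIT.
Qed.

Lemma integrable_period_indic : mu.-integrable setT (EFin \o period_indic).
Proof.
have E : [set x : R | (0 <= x) && (x < 2 * pi)] = `[0, (2 * pi)[%classic.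
  by apply/seteqP; split=> x /=; rewrite in_itv.
apply: (@integrable_indicator (fun y => (0 <= y) && (y < 2 * pi))); rewrite E.
  exact: measurable_itv.
by rewrite lebesgue_measure_itv/=; case: ifP => // _; rewrite -EFinB ltry.
Qed.

Lemma I4_prod (f1 f2 f3 : R -> R) : mu.-integrable setT (EFin \o f1) ->
  mu.-integrable setT (EFin \o f2) -> mu.-integrable setT (EFin \o f3) ->
  I4 (fun p => f1 p.1.1.1 * f2 p.1.1.2 * f3 p.1.2).
Proof.
move=> i1 i2 i3.
have i12 := integrable_prodM (m1 := S1) (m2 := S1) i1 i2.
have i123 := integrable_prodM (m1 := S2) (m2 := S1) i12 i3.
exact: (integrable_prodM (m1 := S3) (m2 := S1) i123 integrable_period_indic).
Qed.

Lemma integrable_itv_indic (M : R) :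
  mu.-integrable setT (EFin \o (fun x => if `|x| <= M then 1 else 0)).
Proof.
have E : [set x : R | `|x| <= M] = `[(- M), M]%classic.
  by apply/seteqP; split=> x /=; rewrite in_itv/= ler_norml.
apply: (@integrable_indicator (fun y => `|y| <= M)); rewrite E.
  exact: measurable_itv.
by rewrite lebesgue_measure_itv/=; case: ifP => // _; rewrite -EFinB ltry.
Qed.

Definition far (M : R) p := M < `|p.1.1.1| \/ M < `|p.1.1.2| \/ M < `|p.1.2|.

(** Integrability of pairings with test functions: [F] is bounded on the compact box [B], whose
    [y]-side is the closed period, and vanishes outside it over one period. *)
Lemma I4_compact F G (M K : R) : measurable_fun setT G -> (forall p, `|G p| <= K) ->
  continuous F -> (forall p, far M p -> F p = 0) -> I4 (fun p => G p * F p).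
Proof.
move=> mG GK cF FM.
have K0 : 0 <= K by apply: le_trans (GK (0, 0, 0, 0)).
pose B : set (pt R) := ((`[(- M), M]%classic `*` `[(- M), M]%classic) `*`
  `[(- M), M]%classic) `*` `[0, 2 * pi]%classic.
have cB : compact B.
  by do ! apply: compact_setX; exact: segment_compact.
have : compact (F @` B) by apply: continuous_compact => //; exact: continuous_subspaceT.
move=> /compact_bounded [A [_ hA]].
have {}hA p : B p -> `|F p| <= `|A| + 1.
  by move=> Bp; apply: (hA (`|A| + 1)); [rewrite (le_lt_trans (ler_norm A))// ltrDl|exists p].
pose c (x : R) : R := if `|x| <= M then 1 else 0.
apply: (@I4_dominated _ (fun p => (K * (`|A| + 1)) * (c p.1.1.1 * c p.1.1.2 * c p.1.2))).
- by apply: measurable_funM => //; exact: measurable_continuous_pt.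
- move=> p py; rewrite normrM /c.
  have nf : 0 <= K * (`|A| + 1) by rewrite mulr_ge0// addr_ge0.
  case: ifPn => [h1|]; last by rewrite -ltNge => h; rewrite FM; [rewrite normr0 !(mulr0, mul0r)|left].
  case: ifPn => [h2|]; last by rewrite -ltNge => h; rewrite FM; [rewrite normr0 !(mulr0, mul0r)|right; left].
  case: ifPn => [h3|]; last by rewrite -ltNge => h; rewrite FM; [rewrite normr0 !(mulr0, mul0r)|right; right].
  rewrite !mulr1; apply: ler_pM => //; apply: hA.
  move: py => /andP[y0 y1].
  by split; [split; [split|]|]; rewrite /= in_itv/= -?ler_norml// y0 ltW.
- by apply: I4Z; apply: I4_prod; exact: integrable_itv_indic.
Qed.

Lemma updK i p : upd i p (coord i p) = p.
Proof.
by case: p => [[[a b] c] e]; case: i => [[|[|[|[|//]]]] Hi].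
Qed.

Lemma upd_upd i p s t : upd i (upd i p s) t = upd i p t.
Proof. by case: i => [[|[|[|[|//]]]] Hi]. Qed.

Lemma coord_upd i p t : coord i (upd i p t) = t.
Proof. by case: i => [[|[|[|[|//]]]] Hi]. Qed.

Lemma test_fun_continuous (phi : pt R -> R) (l : seq 'I_4) :
  test_fun phi -> continuous (iter_partial l phi).
Proof. by case=> -[h _] _; exact: h. Qed.

Lemma test_fun_is_derive (phi : pt R -> R) i p (t : R) : test_fun phi ->
  is_derive t 1 (fun s => phi (upd i p s)) (partial i phi (upd i p t)).
Proof.
move=> [[_ h] _]; have := h [::] i (upd i p t); rewrite coord_upd/=.
have E : (fun s : R => phi (upd i (upd i p t) s)) = (fun s => phi (upd i p s)).
  by apply/funext => s; rewrite upd_upd.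
by rewrite /partial E coord_upd derive1E => /derivableP.
Qed.

Lemma near_abs_gt (M : R) (f : R -> R) (t : R) : {for t, continuous f} ->
  M < `|f t| -> \forall s \near t, M < `|f s|.
Proof. by move=> cf Mt; exact: (cvgr_gt _ (cvg_norm cf) _ Mt). Qed.

Lemma continuous_upd_coord i p (t : R) :
  [/\ {for t, continuous (fun s => (upd i p s).1.1.1)},
      {for t, continuous (fun s => (upd i p s).1.1.2)} &
      {for t, continuous (fun s => (upd i p s).1.2)}].
Proof.
by case: i => [[|[|[|[|//]]]] Hi]; split; rewrite /upd/=;
  first [exact: cvg_id|exact: cvg_cst].
Qed.

(** [far] is an open condition, so [phi] vanishes identically near such a point along each axis, and
    so do its partial derivatives. *)
Lemma test_fun_far (phi : pt R -> R) : test_fun phi ->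
  exists M, forall p, far M p -> phi p = 0 /\ forall i, partial i phi p = 0.
Proof.
move=> tp; have [_ [_ [M hM]]] := tp; exists M => p fp; split; first exact: hM.
move=> i; rewrite /partial.
have E : \forall s \near coord i p, cst (0 : R) s = phi (upd i p s).
  have [c1 c2 c3] := continuous_upd_coord i p (coord i p).
  have near_far : \forall s \near coord i p, far M (upd i p s).
    move: fp; rewrite -{1}(updK i p) => -[h|[h|h]].
    - by apply: filterS (near_abs_gt c1 h) => s hs; left.
    - by apply: filterS (near_abs_gt c2 h) => s hs; right; left.
    - by apply: filterS (near_abs_gt c3 h) => s hs; right; right.
  by apply: filterS near_far => s hs /=; rewrite hM.
by rewrite (der_derive1 (near_eq_is_derive E (der_cst (coord i p) 0))).
Qed.

Lemma ae_neq0 : {ae mu, forall x : R, x != 0}.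
Proof.
exists [set 0]; split=> //; first exact: lebesgue_measure_set1.
by move=> x /= /negP; rewrite negbK => /eqP.
Qed.

Lemma ae_fst_neq0 : {ae S2, forall x : R * R, x.1 != 0}.
Proof.
exists ([set 0] `*` setT); split.
- by apply: measurableX.
- transitivity (mu [set 0%R] * mu setT)%E; first exact: (@product_measure1E _ _ _ _ _ S1 S1).
  by rewrite lebesgue_measure_set1 mul0e.
- by move=> x /= /negP; rewrite negbK => /eqP.
Qed.

(* A sufficient condition for the line through [p] along the i-th axis to miss the
   singular set [rho = 0], violated only on a null set. *)
Definition off_axis i p := if val i == 2 then p.1.1.1 != 0 else p.1.2 != 0.

(** Fubini's theorem is iterated so that the i-th variable is isolated; the discarded null set is
    [x3 = 0] for the first two axes and [x1 = 0] for the third. *)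
Lemma integral4_lines_eq0 i (F : pt R -> \bar R) : (i < 3)%N -> M4.-integrable setT F ->
  (forall p, off_axis i p -> (\int[mu]_t F (upd i p t) = 0)%E) ->
  (\int[M4]_p F p = 0)%E.
Proof.
move=> i3 iF h; apply: (integral_prod_eq0_ae2 (m1 := S3) (m2 := S1) iF).
apply: filterS (ae_integrable2 (m1 := S3) (m2 := S1) iF) => y iy.
move: i i3 h => [[|[|[|[|//]]]] Hi] // _ h.
- apply: (integral_prod_eq0_ae2 (m1 := S2) (m2 := S1) iy).
  apply: filterS2 (ae_integrable2 (m1 := S2) (m2 := S1) iy) ae_neq0 => x3 i3 x30.
  apply: (integral_prod_eq0_ae2 (m1 := S1) (m2 := S1) i3); apply: aeW => x2.
  exact: (h (0, x2, x3, y)).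
- apply: (integral_prod_eq0_ae2 (m1 := S2) (m2 := S1) iy).
  apply: filterS2 (ae_integrable2 (m1 := S2) (m2 := S1) iy) ae_neq0 => x3 i3 x30.
  apply: (integral_prod_eq0_ae1 (m1 := S1) (m2 := S1) i3); apply: aeW => x1.
  exact: (h (x1, 0, x3, y)).
- apply: (integral_prod_eq0_ae1 (m1 := S2) (m2 := S1) iy).
  apply: (@filterS _ _ (ae_filter_ringOfSetsType S2) _ _ _ ae_fst_neq0) => -[x1 x2] x10.
  exact: (h (x1, x2, 0, y)).
Qed.

Lemma upd_snd i p (t : R) : (i < 3)%N -> (upd i p t).2 = p.2.
Proof. by case: i => [[|[|[|[|//]]]] Hi]. Qed.

Lemma far_upd i p (t M : R) : (i < 3)%N -> M < `|t| -> far M (upd i p t).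
Proof.
by case: i => [[|[|[|[|//]]]] Hi] // _ h; [left|right; left|right; right].
Qed.

End four_dim.

(** * Weak integration by parts, square integrability and rescaling *)

Section ground_state.
Variable R : realType.
Local Notation mu := (@lebesgue_measure R).
Local Notation S1 := (S1 R).
Local Notation S2 := (S2 R).
Local Notation S3 := (S3 R).
Local Notation M4 := (M4 R).
Implicit Types (p : pt R) (F G H : pt R -> R) (i : 'I_4).

(** On a line off the singular set the integrand is the derivative of the compactly supported
    [F * phi], and the period indicator is constant since [i < 3]. *)
Lemma weak_ibp i F H (K K' : R) (phi : pt R -> R) : (i < 3)%N -> test_fun phi ->
  measurable_fun setT F -> measurable_fun setT H ->
  (forall p, `|F p| <= K) -> (forall p, `|H p| <= K') ->
  (forall p (t : R), off_axis i p ->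
    is_derive t 1 (fun s => F (upd i p s)) (H (upd i p t))) ->
  (forall p, off_axis i p -> continuous (fun s : R => H (upd i p s))) ->
  [/\ I4 (fun p => F p * partial i phi p), I4 (fun p => H p * phi p) &
      integral4 (fun p => F p * partial i phi p + H p * phi p) = 0].
Proof.
move=> i3 tp mF mH FK HK dF cH.
have [M hM] := test_fun_far tp.
have cphi : continuous phi := @test_fun_continuous _ phi [::] tp.
have cdphi : continuous (partial i phi) := @test_fun_continuous _ phi [:: i] tp.
have I1 : I4 (fun p => F p * partial i phi p).
  by apply: (@I4_compact _ _ _ M K) => // p /hM[_].
have I2 : I4 (fun p => H p * phi p).
  by apply: (@I4_compact _ _ _ M K') => // p /hM[].
split=> //; rewrite integral4E.
rewrite /Rintegral (@integral4_lines_eq0 _ i)//.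
  rewrite (_ : (fun p => _) = (EFin \o (fun p => F p * partial i phi p * period_indic p.2)%R) \+
    (EFin \o (fun p => H p * phi p * period_indic p.2)%R))%E; first exact: integrableD.
  by apply/funext => p /=; rewrite mulrDl.
move=> p op.
apply: (@integral_derive_compact _ (fun t => F (upd i p t) * phi (upd i p t) * period_indic p.2) _ M).
- move=> t; rewrite upd_snd//.
  apply: (is_derive_eq (der_mul (der_mul (dF p t op) (test_fun_is_derive i p t tp)) (der_cst t (period_indic p.2)))).
  by ring.
- move=> t; under eq_fun do rewrite upd_snd//.
  apply: cvgM; last exact: cvg_cst.
  apply: cvgD; apply: cvgM.
  + exact: (der_continuous (dF p t op)).
  + exact: (@continuous_line _ _ i p cdphi t).
  + exact: (cH p op t).
  + exact: (@continuous_line _ _ i p cphi t).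
- by move=> t Mt; have [-> _] := hM _ (far_upd p i3 Mt); rewrite mulr0 mul0r.
Qed.


Lemma integral4D F G : I4 F -> I4 G ->
  integral4 (fun p => F p + G p) = integral4 F + integral4 G.
Proof.
move=> iF iG; rewrite !integral4E -RintegralD//.
by congr (Rintegral _ _ _); apply/funext => p; rewrite mulrDl.
Qed.

Lemma I4D F G : I4 F -> I4 G -> I4 (fun p => F p + G p).
Proof.
move=> iF iG; rewrite /I4.
rewrite (_ : (fun p => _) = (fun p => F p * period_indic p.2 + G p * period_indic p.2)).
  by have := integrableD measurableT iF iG.
by apply/funext => p; rewrite mulrDl.
Qed.

Lemma integral_period_derive (h h' : R -> R) :
  (forall t : R, is_derive t 1 h (h' t)) -> continuous h' ->
  (\int[mu]_t (h' t * period_indic t)%:E = (h (2 * pi))%:E - (h 0)%:E)%E.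
Proof.
move=> dh ch'.
have pi2 : 0 < 2 * pi :> R by rewrite mulr_gt0// pi_gt0.
transitivity (\int[mu]_(t in `[0%R, (2 * pi)%R[) (h' t)%:E)%E.
  rewrite [RHS]integral_mkcond; apply: eq_integral => t _.
  rewrite patchE /period_indic; case: ifPn => ht; case: ifPn => //.
  - by rewrite mulr1.
  - by rewrite notin_setE/= in_itv/= ht.
  - by rewrite inE/= in_itv/= (negbTE ht).
  - by rewrite mulr0.
rewrite integral_itv_bndo_bndc; last first.
  by apply/measurable_EFinP; apply: measurable_funTS; exact: continuous_measurable_fun.
have ch : continuous h by move=> t; exact: (der_continuous (dh t)).
rewrite (@continuous_FTC2 _ h' h)//.
- exact: continuous_subspaceT.
- split; first by move=> x _; exact: der_derivable (dh x).
    by apply: cvg_at_right_filter; exact: ch.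
  by apply: cvg_at_left_filter; exact: ch.
- by move=> x _; exact: der_derive1 (dh x).
Qed.

(** [F] factors out of the integral in [y], which leaves the increment of [phi] over one period. *)
Lemma weak_ibp_y F (K : R) (phi : pt R -> R) : test_fun phi ->
  measurable_fun setT F -> (forall p, `|F p| <= K) ->
  (forall p t, F (upd ord_max p t) = F p) ->
  integral4 (fun p => F p * partial ord_max phi p) = 0.
Proof.
move=> tp mF FK Fy.
have [M hM] := test_fun_far tp.
have cdphi : continuous (partial ord_max phi) := @test_fun_continuous _ phi [:: ord_max] tp.
have I1 : I4 (fun p => F p * partial ord_max phi p).
  by apply: (@I4_compact _ _ _ M K) => // p /hM[_].
rewrite integral4E /Rintegral.
rewrite (integral_prod_eq0_ae1 (m1 := S3) (m2 := S1) I1)//; apply: aeW => x.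
pose q : pt R := (x, 0).
have qE y : (x, y) = upd ord_max q y by rewrite /q; case: (x) => [[? ?] ?].
transitivity (\int[mu]_y ((F q * partial ord_max phi (upd ord_max q y)) * period_indic y)%:E)%E.
  by apply: eq_integral => y _; rewrite /= qE Fy.
have [_ [per _]] := tp.
have dh (t : R) : is_derive t 1 (fun y => F q * phi (upd ord_max q y))
    (F q * partial ord_max phi (upd ord_max q t)).
  apply: (is_derive_eq (der_mul (der_cst t (F q)) (test_fun_is_derive ord_max q t tp))).
  by rewrite mul0r add0r.
have ch : continuous (fun y => F q * partial ord_max phi (upd ord_max q y)).
  move=> t; apply: cvgM; first exact: cvg_cst.
  exact: (@continuous_line _ _ ord_max q cdphi t).
rewrite (integral_period_derive dh ch).
have := per q; rewrite /= add0r => ->.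
by have := updK ord_max q; rewrite /coord/= => ->; rewrite subee.
Qed.

(** For [a], [b], [e] the squared coordinates and [f] a squared function, decay in the radius
    becomes decay in a product of one-variable weights, through [(1 + s)^3 <= 4 (1 + s^3)]. *)
Lemma mul_oneDsqr_le (f k a b e : R) : f <= k -> (a + b + e) ^+ 3 * f <= k -> 0 <= f ->
  0 <= a -> 0 <= b -> 0 <= e -> f * ((1 + a) * (1 + b) * (1 + e)) <= 8 * k.
Proof.
move=> h1 h2 h3 a0 b0 e0.
have s0 : 0 <= a + b + e by rewrite !addr_ge0.
have P : (1 + a) * (1 + b) * (1 + e) <= (1 + (a + b + e)) ^+ 3.
  rewrite exprSr expr2; apply: ler_pM; [by rewrite mulr_ge0//; lra|lra| |lra].
  by apply: ler_pM; lra.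
have Q : (1 + (a + b + e)) ^+ 3 <= 4 * (1 + (a + b + e) ^+ 3).
  move: (a + b + e) s0 => s s0'; rewrite -subr_ge0.
  have -> : 4 * (1 + s ^+ 3) - (1 + s) ^+ 3 = 3 * (1 + s) * (1 - s) ^+ 2 by ring.
  by rewrite mulr_ge0 ?sqr_ge0//; lra.
apply: (@le_trans _ _ (f * (4 * (1 + (a + b + e) ^+ 3)))).
  by apply: ler_wpM2l => //; exact: le_trans Q.
have -> : f * (4 * (1 + (a + b + e) ^+ 3)) = 4 * f + 4 * ((a + b + e) ^+ 3 * f) by ring.
by move: ((a + b + e) ^+ 3 * f) h2 => g g2; lra.
Qed.

(** Comparison with a tensor product of one-variable functions, in place of polar coordinates. *)
Lemma L2_decay F (K : R) : measurable_fun setT F -> (forall p, `|F p| <= K) ->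
  (forall p, rho p ^+ 3 * `|F p| <= K) -> L2 F.
Proof.
move=> mF FK FrK; split; first exact: measurable_funTS.
apply/I4P.
pose c (x : R) : R := (oneDsqr x)^-1.
have iG : I4 (fun p => c p.1.1.1 * c p.1.1.2 * c p.1.2).
  by apply: I4_prod; exact: integrable_oneDsqrV.
apply: (@I4_dominated _ _ (fun p => (8 * K ^+ 2) * (c p.1.1.1 * c p.1.1.2 * c p.1.2))).
- exact: measurable_funX.
- move=> p _; rewrite ger0_norm ?sqr_ge0//.
  have a0 := sqr_ge0 p.1.1.1; have b0 := sqr_ge0 p.1.1.2; have e0 := sqr_ge0 p.1.2.
  rewrite /c /oneDsqr -!invfM ler_pdivlMr; last by rewrite !mulr_gt0//; lra.
  have h1 : F p ^+ 2 <= K ^+ 2.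
    by rewrite -(real_normK (num_real (F p))) lerXn2r ?nnegrE ?(le_trans _ (FK p)).
  have h2 : (rho p ^+ 2) ^+ 3 * F p ^+ 2 <= K ^+ 2.
    rewrite -(real_normK (num_real (F p))) exprAC -exprMn lerXn2r ?nnegrE//.
      by rewrite mulr_ge0// exprn_ge0// rho_ge0.
    by rewrite (le_trans _ (FK p)).
  have h3 := sqr_ge0 (F p); rewrite rho_sqr in h2.
  exact: mul_oneDsqr_le.
- exact: I4Z.
Qed.

(* [phi] and [psi] are the profile and its derivative divided by [r], for the
   radial equation [phi'' + 2 phi' / r = lam phi - 2 phi ^ 3]. *)
Definition radial_sol (lam K : R) (phi psi : R -> R) :=
  [/\ forall r, 0 < phi r,
      forall r, 0 <= r -> [/\ phi r <= K, `|psi r| <= K,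
        r ^+ 3 * phi r <= K & r ^+ 4 * `|psi r| <= K] &
      forall r : R, 0 < r -> is_derive r 1 phi (r * psi r) /\
        is_derive r 1 psi ((lam * phi r - 2 * phi r ^+ 3 - 3 * psi r) / r)].

(** With dilation [k] and amplitude [b] the linear coefficient becomes [k ^+ 2] and the cubic one
    [c * k ^+ 2 / b ^+ 2], which the last hypothesis sets to 2. In [psi] one factor [k] comes from
    the chain rule, the other from [k * r]. *)
Lemma rescaled_profile (c K k b : R) phi psi : is_profile c K phi psi -> 0 < k -> 0 < b ->
  2 * b ^+ 2 = c * k ^+ 2 ->
  exists K', radial_sol (k ^+ 2) K' (fun r => b * phi (k * r)) (fun r => b * k ^+ 2 * psi (k * r)).
Proof.
move=> [pos sol] k0 b0 bk.
(* [is_profile] bounds nothing at 0, whereas [radial_sol] includes [r = 0]. *)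
pose K0 := `|K| + `|phi 0| + `|psi 0|.
have bd s : 0 <= s -> [/\ phi s <= K0, `|psi s| <= K0, s ^+ 3 * phi s <= K0 & s ^+ 4 * `|psi s| <= K0].
  have K1 := ler_norm K; have K2 := normr_ge0 K.
  have p1 := ler_norm (phi 0); have p2 := normr_ge0 (phi 0); have q2 := normr_ge0 (psi 0).
  rewrite le_eqVlt => /orP[/eqP <-|s0].
    by rewrite !expr0n/= !mul0r /K0; split; lra.
  by have [_ _ [h1 h2] h3 h4] := sol s s0; rewrite /K0; split; lra.
have K00 : 0 <= K0 by rewrite /K0 !addr_ge0.
have kk : 0 < k ^+ 2 by rewrite exprn_gt0.
have kV n : 0 < (k ^+ n)^-1 by rewrite invr_gt0 exprn_gt0.
(* The sum of the four powers of [k] that the four bounds produce. *)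
pose A := 1 + k ^+ 2 + (k ^+ 3)^-1 + (k ^+ 2)^-1.
exists (b * A * K0); split.
- by move=> r; rewrite mulr_gt0.
- move=> r r0.
  have kr : 0 <= k * r by rewrite mulr_ge0// ltW.
  have [h1 h2 h3 h4] := bd _ kr.
  have f0 := ltW (pos (k * r)); have g0 := normr_ge0 (psi (k * r)).
  have k2 := kV 2%N; have k3 := kV 3%N.
  have gen a x : 0 <= a -> a <= A -> x <= K0 -> b * (a * x) <= b * A * K0.
    move=> a0 aA xK; rewrite -mulrA ler_pM2l//.
    by apply: (le_trans (ler_wpM2l a0 xK)); rewrite ler_wpM2r.
  rewrite normrM (gtr0_norm (mulr_gt0 b0 kk)); split.
  + by rewrite -[phi _]mul1r; apply: gen => //; rewrite /A; lra.
  + by rewrite -mulrA; apply: gen => //; rewrite /A; lra.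
  + have -> : r ^+ 3 * (b * phi (k * r)) = b * ((k ^+ 3)^-1 * ((k * r) ^+ 3 * phi (k * r))).
      by field; rewrite gt_eqF.
    by apply: gen => //; rewrite /A; lra.
  + have -> : r ^+ 4 * (b * k ^+ 2 * `|psi (k * r)|) =
        b * ((k ^+ 2)^-1 * ((k * r) ^+ 4 * `|psi (k * r)|)).
      by field; rewrite gt_eqF.
    by apply: gen => //; rewrite /A; lra.
- move=> r r0; have kr : 0 < k * r by rewrite mulr_gt0.
  have [d1 d2 _ _ _] := sol _ kr.
  have dl : is_derive r 1 (fun s : R => k * s) k.
    by apply: (is_derive_eq (der_mul (der_cst r k) (der_id r))); ring.
  split.
    by apply: (is_derive_eq (der_mul (der_cst r b) (der_comp dl d1))); ring.
  apply: (is_derive_eq (der_mul (der_cst r (b * k ^+ 2)) (der_comp dl d2))).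
  have -> : 2 * (b * phi (k * r)) ^+ 3 = (2 * b ^+ 2) * b * phi (k * r) ^+ 3 by ring.
  rewrite bk; generalize (phi (k * r)) (psi (k * r)) => x y.
  by field; rewrite !gt_eqF.
Qed.

End ground_state.

(** * From the radial equation to the weak equation *)

Section radial_solutions.
Variable R : realType.
Implicit Types (p : pt R) (i : 'I_4).
Local Notation o0 := (@Ordinal 4 0 isT).
Local Notation o1 := (@Ordinal 4 1 isT).
Local Notation o2 := (@Ordinal 4 2 isT).

Definition cross_sqr i p : R :=
  match val i with
  | 0 => p.1.1.2 ^+ 2 + p.1.2 ^+ 2
  | 1 => p.1.1.1 ^+ 2 + p.1.2 ^+ 2
  | _ => p.1.1.1 ^+ 2 + p.1.1.2 ^+ 2 end.

Lemma rho_upd i p (t : R) : (i < 3)%N -> rho (upd i p t) = Num.sqrt (t ^+ 2 + cross_sqr i p).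
Proof.
by case: i => [[|[|[|[|//]]]] Hi] // _; congr Num.sqrt; rewrite /cross_sqr/=; ring.
Qed.

Lemma cross_sqr_gt0 i p : (i < 3)%N -> off_axis i p -> 0 < cross_sqr i p.
Proof.
by case: i => [[|[|[|[|//]]]] Hi] // _; rewrite /off_axis/cross_sqr/= => h;
  [apply: ltr_wpDl; rewrite ?sqr_ge0// exprn_even_gt0|
   apply: ltr_wpDl; rewrite ?sqr_ge0// exprn_even_gt0|
   apply: ltr_pwDl; rewrite ?sqr_ge0// exprn_even_gt0].
Qed.

Lemma rho_upd_gt0 i p (t : R) : (i < 3)%N -> off_axis i p -> 0 < rho (upd i p t).
Proof.
move=> i3 op; rewrite rho_upd// sqrtr_gt0.
by apply: ltr_wpDl; [exact: sqr_ge0|exact: cross_sqr_gt0].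
Qed.

Lemma is_derive_rho i p (t : R) : (i < 3)%N -> off_axis i p ->
  is_derive t 1 (fun s => rho (upd i p s)) (t / rho (upd i p t)).
Proof.
move=> i3 op.
have -> : (fun s => rho (upd i p s)) = (fun s => Num.sqrt (s ^+ 2 + cross_sqr i p)).
  by apply/funext => s; rewrite rho_upd.
have g0 : 0 < t ^+ 2 + cross_sqr i p.
  by apply: ltr_wpDl; [exact: sqr_ge0|exact: cross_sqr_gt0].
apply: (is_derive_eq (der_comp (der_add (der_sqr (der_id t)) (der_cst t (cross_sqr i p))) (is_derive1_sqrt g0))).
rewrite rho_upd//.
have : 0 < Num.sqrt (t ^+ 2 + cross_sqr i p) by rewrite sqrtr_gt0.
by move: (Num.sqrt _) => q q0; field; rewrite gt_eqF.
Qed.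

Section fixed_profile.
Variables (lam K : R) (phi psi : R -> R).
Hypothesis sol : radial_sol lam K phi psi.

Let posphi r : 0 < phi r. Proof. by have [h _ _] := sol. Qed.
Let dphi (r : R) : 0 < r -> is_derive r 1 phi (r * psi r).
Proof. by have [_ _ h] := sol => /h[]. Qed.
Let dpsi (r : R) : 0 < r ->
  is_derive r 1 psi ((lam * phi r - 2 * phi r ^+ 3 - 3 * psi r) / r).
Proof. by have [_ _ h] := sol => /h[]. Qed.

Definition usol p := phi (rho p).
Definition gsol i p := if (i < 3)%N then coord i p * psi (rho p) else 0.
(** The Laplacian of [usol], as prescribed by the radial equation. *)
Definition Nsol p := lam * usol p - 2 * usol p ^+ 3.
(* The second derivative of the radial function along the i-th axis; this form,
   in which the angular part has trace zero, keeps the three of them summing to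
   [Nsol] on the axis [rho = 0] as well. *)
Definition hsol i p := Nsol p / 3 +
  (coord i p ^+ 2 - rho p ^+ 2 / 3) / rho p ^+ 2 * (Nsol p - 3 * psi (rho p)).

Lemma measurable_usol : measurable_fun setT usol.
Proof. by apply: measurable_radial => r r0; exact: der_continuous (dphi r0). Qed.

Lemma measurable_psi_rho : measurable_fun setT (fun p => psi (rho p)).
Proof. by apply: measurable_radial => r r0; exact: der_continuous (dpsi r0). Qed.

Lemma measurable_gsol i : measurable_fun setT (gsol i).
Proof.
have [i3|i3] := boolP (i < 3)%N; last first.
  rewrite (_ : gsol i = cst 0); first exact: measurable_cst.
  by apply/funext => p; rewrite /gsol (negbTE i3).
rewrite (_ : gsol i = (fun p => coord i p * psi (rho p))); last first.
  by apply/funext => p; rewrite /gsol i3.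
by apply: measurable_funM; [exact: measurable_coord|exact: measurable_psi_rho].
Qed.

Lemma measurable_Nsol : measurable_fun setT Nsol.
Proof. by have mu1 := measurable_usol; rewrite /Nsol; meas. Qed.

Lemma measurable_hsol i : measurable_fun setT (hsol i).
Proof.
have m1 := measurable_Nsol; have m2 := @measurable_coord R i.
have m3 := @measurable_rho R; have m4 := measurable_psi_rho.
by rewrite /hsol; meas.
Qed.

Lemma usol_le p : `|usol p| <= K.
Proof.
have [_ h _] := sol; have [h1 _ _ _] := h _ (rho_ge0 p).
by rewrite gtr0_norm// posphi.
Qed.

Lemma usol_decay p : rho p ^+ 3 * `|usol p| <= K.
Proof.
have [_ h _] := sol; have [_ _ h1 _] := h _ (rho_ge0 p).
by rewrite gtr0_norm// posphi.
Qed.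

Lemma K_ge0 : 0 <= K.
Proof. exact: le_trans (usol_le (0, 0, 0, 0)). Qed.

Lemma gsol_decay i p : rho p ^+ 3 * `|gsol i p| <= K.
Proof.
rewrite /gsol; case: ifPn => [i3|_]; last by rewrite normr0 mulr0 K_ge0.
have [_ h _] := sol; have [_ _ _ h1] := h _ (rho_ge0 p).
apply: le_trans h1; rewrite normrM mulrA ler_wpM2r// (exprSr (rho p) 3).
by rewrite ler_wpM2l ?exprn_ge0 ?rho_ge0// coord_le_rho.
Qed.

Lemma gsol_le i p : `|gsol i p| <= K.
Proof.
have [r1|r1] := leP (rho p) 1; last first.
  apply: le_trans (gsol_decay i p).
  by rewrite ler_peMl// exprn_ege1// ltW.
rewrite /gsol; case: ifPn => [i3|_]; last by rewrite normr0 K_ge0.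
have [_ h _] := sol; have [_ h1 _ _] := h _ (rho_ge0 p).
apply: le_trans h1; rewrite normrM ler_piMl//.
exact: le_trans (coord_le_rho p i3) r1.
Qed.

Definition boundN := `|lam| * K + 2 * K ^+ 3.

Lemma Nsol_le p : `|Nsol p| <= boundN.
Proof.
apply: (le_trans (ler_normB _ _)); rewrite normrM [`|2 * _|]normrM normrX (ger0_norm (ler0n _ 2)).
apply: lerD; first by rewrite ler_wpM2l// usol_le.
by rewrite ler_pM2l// lerXn2r ?nnegrE ?K_ge0// usol_le.
Qed.

Lemma hsol_le i p : (i < 3)%N -> `|hsol i p| <= 2 * boundN + 3 * K.
Proof.
move=> i3; have n1 := Nsol_le p.
have [_ h _] := sol; have [_ n2 _ _] := h _ (rho_ge0 p).
have n3 : `|Nsol p - 3 * psi (rho p)| <= boundN + 3 * K.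
  apply: (le_trans (ler_normB _ _)); apply: lerD => //.
  by rewrite normrM ger0_norm// ler_pM2l.
have n4 : `|(coord i p ^+ 2 - rho p ^+ 2 / 3) / rho p ^+ 2| <= 1.
  have [->|r0] := eqVneq (rho p) 0; first by rewrite expr0n/= invr0 mulr0 normr0.
  have r2 : 0 < rho p ^+ 2 by rewrite exprn_even_gt0.
  rewrite normrM normfV (gtr0_norm r2) ler_pdivrMr// mul1r.
  have c1 := coord_sqr_le p i3; have c2 := sqr_ge0 (coord i p).
  move: (coord i p ^+ 2) (rho p ^+ 2) c1 c2 r2 => x y c1 c2 r2.
  by rewrite ler_norml; apply/andP; split; lra.
have n5 : `|Nsol p / 3| <= boundN.
  rewrite normrM normfV (ger0_norm (ler0n _ 3)) ler_pdivrMr//.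
  by move: (`|Nsol p|) n1 (normr_ge0 (Nsol p)) => x n1 x0; lra.
apply: (le_trans (ler_normD _ _)); rewrite [X in _ + X]normrM.
have n6 : `|(coord i p ^+ 2 - rho p ^+ 2 / 3) / rho p ^+ 2| * `|Nsol p - 3 * psi (rho p)|
    <= 1 * (boundN + 3 * K) by apply: ler_pM.
apply: (le_trans (lerD n5 n6)).
by generalize boundN => z; lra.
Qed.

Lemma sum_hsol p :
  hsol o0 p + hsol o1 p + hsol o2 p = Nsol p.
Proof.
have E : coord o0 p ^+ 2 + coord o1 p ^+ 2 + coord o2 p ^+ 2 = rho p ^+ 2.
  by rewrite rho_sqr.
(* On the axis the angular coefficient is a quotient by 0, hence 0, and the three thirds of [Nsol]
   remain. *)
rewrite /hsol; have [r0|r0] := eqVneq (rho p) 0.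
  by rewrite r0 expr0n/= invr0 !(mulr0, mul0r, addr0); lra.
move: E; generalize (coord o0 p ^+ 2) (coord o1 p ^+ 2) (coord o2 p ^+ 2).
move=> a b e E; have -> : e = rho p ^+ 2 - a - b by rewrite -E; ring.
by generalize (Nsol p) (psi (rho p)) (rho p) r0 => x y r r0'; field.
Qed.

Lemma is_derive_usol i p (t : R) : (i < 3)%N -> off_axis i p ->
  is_derive t 1 (fun s => usol (upd i p s)) (gsol i (upd i p t)).
Proof.
move=> i3 op; have r0 := rho_upd_gt0 t i3 op.
apply: (is_derive_eq (der_comp (is_derive_rho t i3 op) (dphi r0))).
rewrite /gsol i3 coord_upd.
by generalize (rho (upd i p t)) r0 => r r0'; field; rewrite gt_eqF.
Qed.

Lemma is_derive_psi_rho i p (t : R) : (i < 3)%N -> off_axis i p ->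
  is_derive t 1 (fun s => psi (rho (upd i p s)))
    (t / rho (upd i p t) ^+ 2 * (Nsol (upd i p t) - 3 * psi (rho (upd i p t)))).
Proof.
move=> i3 op; have r0 := rho_upd_gt0 t i3 op.
apply: (is_derive_eq (der_comp (is_derive_rho t i3 op) (dpsi r0))).
rewrite /Nsol /usol.
generalize (rho (upd i p t)) r0 => r r0'; generalize (phi r) (psi r) => x y.
by field; rewrite gt_eqF.
Qed.

Lemma is_derive_gsol i p (t : R) : (i < 3)%N -> off_axis i p ->
  is_derive t 1 (fun s => gsol i (upd i p s)) (hsol i (upd i p t)).
Proof.
move=> i3 op; have r0 := rho_upd_gt0 t i3 op.
have -> : (fun s => gsol i (upd i p s)) = (fun s => s * psi (rho (upd i p s))).
  by apply/funext => s; rewrite /gsol i3 coord_upd.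
apply: (is_derive_eq (der_mul (der_id t) (is_derive_psi_rho t i3 op))).
rewrite /hsol coord_upd.
generalize (rho (upd i p t)) r0 => r r0'; generalize (Nsol (upd i p t)) (psi r) => x y.
by field; rewrite gt_eqF.
Qed.

Lemma continuous_hsol i p : (i < 3)%N -> off_axis i p ->
  continuous (fun s : R => hsol i (upd i p s)).
Proof.
move=> i3 op t; have r0 := rho_upd_gt0 t i3 op.
have cu := der_continuous (is_derive_usol t i3 op).
have cp := der_continuous (is_derive_psi_rho t i3 op).
have cr := der_continuous (is_derive_rho t i3 op).
have cN : {for t, continuous (fun s => Nsol (upd i p s))}.
  apply: cvgB; apply: cvgM; [exact: cvg_cst|exact: cu|exact: cvg_cst|].
  exact: (cvgM cu (cvgM cu cu)).
have cr2 : {for t, continuous (fun s => rho (upd i p s) ^+ 2)} := cvgM cr cr.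
have -> : (fun s => hsol i (upd i p s)) = (fun s => Nsol (upd i p s) / 3 +
    (s * s - rho (upd i p s) ^+ 2 / 3) / rho (upd i p s) ^+ 2 *
    (Nsol (upd i p s) - 3 * psi (rho (upd i p s)))).
  by apply/funext => s; rewrite /hsol coord_upd -expr2.
apply: cvgD; first by apply: cvgM; [exact: cN|exact: cvg_cst].
apply: cvgM.
  apply: cvgM.
    apply: cvgB; first by apply: cvgM; exact: cvg_id.
    by apply: cvgM; [exact: cr2|exact: cvg_cst].
  by apply: cvgV; [rewrite gt_eqF// exprn_gt0|exact: cr2].
apply: cvgB; first exact: cN.
by apply: cvgM; [exact: cvg_cst|exact: cp].
Qed.

Lemma rho_upd3 p (t : R) : rho (upd ord_max p t) = rho p.
Proof. by []. Qed.

Lemma weak_grad_usol : weak_grad usol gsol.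
Proof.
move=> tst tt i; have [i3|i3] := ltnP i 3.
  have [I1 I2 E] := weak_ibp i3 tt measurable_usol (measurable_gsol i) usol_le (gsol_le i)
    (fun p t op => is_derive_usol t i3 op)
    (fun p op t => der_continuous (is_derive_gsol t i3 op)).
  by apply/eqP; rewrite -addr_eq0 -integral4D// E.
have -> : i = ord_max by apply/val_inj/anti_leq; rewrite /= i3 -ltnS ltn_ord.
rewrite (weak_ibp_y tt measurable_usol usol_le)// integral4E.
rewrite (_ : (fun p => _) = cst 0); first by rewrite Rintegral_cst// mul0r oppr0.
by apply/funext => p; rewrite /gsol/= !mul0r.
Qed.

(** Each [D i] has integral 0 by parts. Since the [hsol i] sum to [lam * usol - 2 * usol ^+ 3], the
    left integrand is the sum of the [D i] plus [T], the coupled nonlinearity for equal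
    components. *)
Lemma weak_eq_usol : weak_eq lam usol gsol usol.
Proof.
move=> tst tt.
have J i (i3 : (i < 3)%N) := weak_ibp i3 tt (measurable_gsol i) (measurable_hsol i)
    (gsol_le i) (fun p => hsol_le p i3) (fun p t op => is_derive_gsol t i3 op)
    (fun p op => continuous_hsol i3 op).
have [a0 b0 E0] := J o0 isT.
have [a1 b1 E1] := J o1 isT.
have [a2 b2 E2] := J o2 isT.
pose T p := 2 * usol p ^+ 3 * tst p.
have -> : (fun p => (`|usol p| ^+ 2 * usol p + usol p * `|usol p| ^+ 2) * tst p) = T.
  by apply/funext => p; rewrite /T /usol (gtr0_norm (posphi _)); ring.
have IT : I4 T.
  have [M hM] := test_fun_far tt.
  apply: (@I4_compact _ _ _ M (2 * K ^+ 3)).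
  - by have m := measurable_usol; meas.
  - move=> p; rewrite normrM normrX (ger0_norm (ler0n _ 2)) ler_pM2l//.
    by rewrite lerXn2r ?nnegrE ?K_ge0// usol_le.
  - exact: (@test_fun_continuous _ tst [::] tt).
  - by move=> p /hM[].
pose D i p := gsol i p * partial i tst p + hsol i p * tst p.
have -> : (fun p => \sum_(i < 4) gsol i p * partial i tst p + lam * usol p * tst p) =
    (fun p => D o0 p + D o1 p + D o2 p + T p).
  apply/funext => p; rewrite !big_ord_recr big_ord0/= add0r.
  have -> : widen_ord (leqnSn 3) (widen_ord (leqnSn 2) (widen_ord (leqnSn 1) ord_max)) = o0.
    exact/val_inj.
  have -> : widen_ord (leqnSn 3) (widen_ord (leqnSn 2) ord_max) = o1.
    exact/val_inj.
  have -> : widen_ord (leqnSn 3) ord_max = o2.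
    exact/val_inj.
  have -> : gsol ord_max p = 0 by [].
  have := sum_hsol p; rewrite /T /D /Nsol /usol.
  move: (phi (rho p)) => x.
  move: (hsol o0 p) (hsol o1 p) (hsol o2 p) => h0 h1 h2 E.
  have -> : h2 = (lam * x - 2 * x ^+ 3) - h0 - h1 by rewrite -E; ring.
  by ring.
have i0 := I4D a0 b0; have i1 := I4D a1 b1; have i2 := I4D a2 b2.
rewrite integral4D//; last by apply: I4D => //; exact: I4D.
rewrite integral4D//; last exact: I4D.
by rewrite integral4D// /D E0 E1 E2 !add0r.
Qed.

Lemma L2_usol : L2 usol.
Proof. exact: (L2_decay measurable_usol usol_le usol_decay). Qed.

Lemma H1_usol : H1 usol.
Proof.
split; first by move=> p; rewrite /usol rho_upd3.
split; first exact: L2_usol.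
exists gsol; split; last exact: weak_grad_usol.
by move=> i; exact: (L2_decay (measurable_gsol i) (gsol_le i) (gsol_decay i)).
Qed.

End fixed_profile.
End radial_solutions.

(** * Positivity and scaling of the mass *)

Section mass.
Variable R : realType.
Local Notation mu := (@lebesgue_measure R).
Local Notation S1 := (S1 R).
Local Notation S2 := (S2 R).
Local Notation S3 := (S3 R).
Local Notation M4 := (M4 R).
Implicit Types (p : pt R) (F : pt R -> R).

Lemma integral4Z F (a : R) : I4 F -> integral4 (fun p => a * F p) = a * integral4 F.
Proof.
move=> iF; rewrite !integral4E -RintegralZl//.
by congr (Rintegral _ _ _); apply/funext => p; rewrite mulrA.
Qed.

Lemma lebesgue_measure_setT : (mu setT = +oo)%E.
Proof. by rewrite -set_itvE lebesgue_measure_itv. Qed.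

Lemma mu_dom4_neq0 : (M4 (dom4 (R := R)) != 0)%E.
Proof.
have -> : dom4 (R := R) = setT `*` `[0, (2 * pi)[%classic.
  by apply/seteqP; split=> p; rewrite /dom4/= in_itv/=; [split|case].
have pi2 : 0 < 2 * pi :> R by rewrite mulr_gt0// pi_gt0.
have e2 : (S2 setT = +oo)%E.
  rewrite -setXTT; transitivity (mu setT * mu setT)%E; first exact: (@product_measure1E _ _ _ _ _ S1 S1).
  by rewrite lebesgue_measure_setT mulyy.
have e3 : (S3 setT = +oo)%E.
  rewrite -setXTT; transitivity (S2 setT * mu setT)%E; first exact: (@product_measure1E _ _ _ _ _ S2 S1).
  by rewrite e2 lebesgue_measure_setT mulyy.
have -> : (M4 (setT `*` `[0%R, (2 * pi)%R[%classic) = S3 setT * mu `[0%R, (2 * pi)%R[%classic)%E.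
  by apply: (@product_measure1E _ _ _ _ _ S3 S1) => //; exact: measurable_itv.
by rewrite e3 lebesgue_measure_itv/= lte_fin pi2 -EFinB subr0 gt0_mulye// lte_fin.
Qed.

Lemma integral4_gt0 F : measurable_fun setT F -> (forall p, 0 < F p) -> I4 F -> 0 < integral4 F.
Proof.
move=> mF F0 iF.
have Fi p : 0 <= F p * period_indic p.2 by rewrite mulr_ge0 ?period_indic_ge0 ?(ltW (F0 p)).
have ge0 : 0 <= integral4 F by rewrite integral4E; apply: Rintegral_ge0.
rewrite lt_neqAle ge0 andbT; apply/eqP => E.
have mFi : measurable_fun setT (EFin \o (fun p => F p * period_indic p.2)).
  by have /integrableP[] := iF.
have I0 : (\int[M4]_p (EFin \o (fun p => F p * period_indic p.2)%R) p = 0)%E.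
  rewrite -(fineK (integrable_fin_num measurableT iF)).
  by move: E; rewrite integral4E /Rintegral => <-.
have /ae_eq_integral_abs : (\int[M4]_p `|(EFin \o (fun p => F p * period_indic p.2)%R) p| = 0)%E.
  rewrite -[RHS]I0; apply: eq_integral => p _.
  by rewrite gee0_abs// lee_fin Fi.
move=> /(_ measurableT mFi) ae0.
have /eqP := mu_dom4_neq0; apply; apply: measure_negligible; first exact: measurable_dom4.
apply: negligibleS ae0 => p hp /= /(_ I) [] /eqP.
by move: hp; rewrite /dom4/= /period_indic => ->; rewrite mulr1 gt_eqF.
Qed.

(** Only the three unbounded variables are dilated, the identity acting on [y]; hence the exponent
    3. *)
Lemma integral4_radial_scale (f : R -> R) (k : R) : 0 < k -> measurable_fun setT (fun p => f (rho p)) ->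
  I4 (fun p => f (rho p) ^+ 2) ->
  integral4 (fun p => f (k * rho p) ^+ 2) = (k ^+ 3)^-1 * integral4 (fun p => f (rho p) ^+ 2).
Proof.
move=> k0 mf iF.
have kV : 0 <= k^-1 by rewrite invr_ge0 ltW.
have s1 := scales_lebesgue k0.
have s2 := scales_prod (m1 := S1) (m2 := S1) kV kV s1 s1.
have s3 := scales_prod (m1 := S2) (m2 := S1) (mulr_ge0 kV kV) kV s2 s1.
have [_ s4] := scales_prod (m1 := S3) (m2 := S1) (mulr_ge0 (mulr_ge0 kV kV) kV) ler01 s3 (scales_id S1).
rewrite !integral4E /Rintegral.
pose F p := (f (rho p) ^+ 2 * period_indic p.2)%:E.
have mF : measurable_fun setT F by have /integrableP[] := iF.
have F0 p : (0 <= F p)%E by rewrite lee_fin mulr_ge0 ?period_indic_ge0 ?sqr_ge0.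
have fin : (\int[M4]_p F p)%E \is a fin_num := integrable_fin_num measurableT iF.
have -> : (\int[M4]_p (f (k * rho p) ^+ 2 * period_indic p.2)%:E = ((k ^+ 3)^-1)%:E * \int[M4]_p F p)%E.
  transitivity ((k^-1 * k^-1 * k^-1 * 1)%:E * \int[M4]_p F p)%E; last first.
    by congr (_%:E * _)%E; field; rewrite gt_eqF.
  rewrite -(s4 F mF F0); apply: eq_integral => -[[[x1 x2] x3] y] _.
  rewrite /F /=; congr (f _ ^+ 2 * _)%:E.
  rewrite /rho/= !exprMn -!mulrDr sqrtrM ?sqr_ge0// sqrtr_sqr gtr0_norm//.
by rewrite fineM.
Qed.

End mass.

(** * Choice of amplitude and dilation *)

Theorem theorem1p1 (R : realType) (Theta : R) (hTheta : 0 < Theta) :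
  exists (lam1 lam2 : R) (u v : pt R -> R) (gu gv : 'I_4 -> pt R -> R),
    0 <= lam1 * lam2 /\ 0 < lam1 + lam2 /\
    H1 u /\ H1 v /\ weak_grad u gu /\ weak_grad v gv /\
    (forall p, 0 < u p) /\ (forall p, 0 < v p) /\
    weak_eq lam1 u gu v /\ weak_eq lam2 v gv u /\
    integral4 (fun p => u p ^+ 2) = Theta ^+ 2 /\
    integral4 (fun p => v p ^+ 2) = Theta ^+ 2.
Proof.
have [c [K [phi [psi [c0 prof]]]]] := @exists_profile R.
pose b := Num.sqrt (c / 2).
have c2 : 0 < c / 2 by rewrite divr_gt0.
have b0 : 0 < b by rewrite sqrtr_gt0.
have bc : 2 * b ^+ 2 = c by rewrite sqr_sqrtr ?(ltW c2)//; field.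
(* The undilated solution provides the reference mass [m1]. *)
have [K1 sol1] : exists K1, radial_sol (1 ^+ 2) K1 (fun r => b * phi (1 * r))
    (fun r => b * 1 ^+ 2 * psi (1 * r)).
  by apply: (rescaled_profile prof) => //; rewrite bc expr1n mulr1.
pose u1 := usol (fun r => b * phi (1 * r)).
have mu1 : measurable_fun setT u1 := measurable_usol sol1.
have [_ /I4P i1] := L2_usol sol1.
have u1p p : 0 < u1 p by rewrite mulr_gt0//; have [] := prof.
pose m1 := integral4 (fun p => u1 p ^+ 2).
have m10 : 0 < m1.
  by apply: integral4_gt0 => // [|p]; [exact: measurable_funX|rewrite exprn_gt0].
(* The dilated solution has mass [k ^+ 2 * k ^- 3 * m1 = m1 / k], which must equal [Theta ^+ 2]. *)
pose k := m1 / Theta ^+ 2.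
have T2 : 0 < Theta ^+ 2 by rewrite exprn_gt0.
have k0 : 0 < k by rewrite divr_gt0.
have [Kk solk] : exists Kk, radial_sol (k ^+ 2) Kk (fun r => (b * k) * phi (k * r))
    (fun r => (b * k) * k ^+ 2 * psi (k * r)).
  by apply: (rescaled_profile prof) => //; [rewrite mulr_gt0|rewrite exprMn mulrA bc].
have mass : integral4 (fun p => usol (fun r => (b * k) * phi (k * r)) p ^+ 2) = Theta ^+ 2.
  have -> : (fun p => usol (fun r => (b * k) * phi (k * r)) p ^+ 2) =
      (fun p => (k * (b * phi (1 * (k * rho p)))) ^+ 2).
    by apply/funext => p; rewrite /usol mul1r; congr (_ ^+ 2); ring.
  have E : (fun p => (k * (b * phi (1 * rho p))) ^+ 2) = (fun p => k ^+ 2 * u1 p ^+ 2).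
    by apply/funext => p; rewrite exprMn.
  rewrite (@integral4_radial_scale _ (fun r => k * (b * phi (1 * r))))//.
  - rewrite E integral4Z// -/m1 /k; move: m10 T2.
    generalize m1 (Theta ^+ 2) => m T m0 T0.
    by field; rewrite !gt_eqF.
  - by apply: measurable_funM => //; exact: measurable_cst.
  - by rewrite E; exact: I4Z.
pose u := usol (R := R) (fun r => (b * k) * phi (k * r)).
pose g := gsol (R := R) (fun r => (b * k) * k ^+ 2 * psi (k * r)).
have up p : 0 < u p by apply: mulr_gt0; [exact: mulr_gt0|have [] := prof].
have Hu : H1 u := H1_usol solk.
have Wu : weak_grad u g := weak_grad_usol solk.
have Eu : weak_eq (k ^+ 2) u g u := weak_eq_usol solk.
have k2 : 0 < k ^+ 2 by rewrite exprn_gt0.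
exists (k ^+ 2), (k ^+ 2), u, u, g, g.
split; first by rewrite mulr_ge0 ?(ltW k2).
by split; [rewrite addr_gt0|do 10 split => //].
Qed.
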